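(* Let $\mathcal{D}$ be the collection of all $3$-graphs $F\in\mathcal{K}_4^3$ such that $F$ is not a subgraph of $\mathcal{S}_n$ for any $n\ge4$. Then $\mathrm{proj}\,\Omega(\mathcal{D})=[0,1]$ and $g(\mathcal{D},2/3)=2/9$, but there exists an absolute constant $\delta_0>0$ such that $g(\mathcal{D},2/3+\epsilon)<2/9-\delta_0$ for all $\epsilon\in(0,10^{-8})$.
   Context: An $r$-graph $\mathcal{H}$ is a finite vertex set $V(\mathcal{H})$ together with a set of $r$-element subsets of it (edges); $|\mathcal{H}|$ is the number of edges and $v(\mathcal{H})=|V(\mathcal{H})|$. The shadow is $\partial\mathcal{H}=\{A\in\binom{V(\mathcal{H})}{r-1}: A\subset B \text{ for some } B\in\mathcal{H}\}$. For a family $\mathcal{F}$ of $r$-graphs, $\mathcal{H}$ is $\mathcal{F}$-free if it contains no member of $\mathcal{F}$ as a (not necessarily induced) subgraph. The edge density is $d(\mathcal{H})=|\mathcal{H}|/\binom{v(\mathcal{H})}{r}$ and the shadow density is $d(\partial\mathcal{H})=|\partial\mathcal{H}|/\binom{v(\mathcal{H})}{r-1}$. A sequence $(\mathcal{H}_k)_{k\ge1}$ of $r$-graphs is good if $v(\mathcal{H}_k)\to\infty$ and both $\lim_k d(\mathcal{H}_k)$ and $\lim_k d(\partial\mathcal{H}_k)$ exist; it realizes $(x,y)\in[0,1]^2$ if $\lim_k d(\partial\mathcal{H}_k)=x$ and $\lim_k d(\mathcal{H}_k)=y$. The feasible region $\Omega(\mathcal{F})$ is the set of all $(x,y)\in[0,1]^2$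 realized by some good sequence of $\mathcal{F}$-free $r$-graphs; it is closed. $\mathrm{proj}\,\Omega(\mathcal{F})=\{x: \exists y,\ (x,y)\in\Omega(\mathcal{F})\}$ and $g(\mathcal{F},x)=\max\{y:(x,y)\in\Omega(\mathcal{F})\}$ for $x\in\mathrm{proj}\,\Omega(\mathcal{F})$. $\mathcal{K}_{4}^{3}$ is the collection of all $3$-graphs $F$ with at most $\binom{4}{2}=6$ edges such that for some $4$-set $S$ every pair of vertices of $S$ is contained in some edge of $F$. For $n\ge4$ and a fixed $u\in[n]$, $\mathcal{S}_n$ is the $3$-graph on $[n]$ whose edges are all triples $\{u,v,w\}$ with $\{v,w\}\subset[n]\setminus\{u\}$ (a star). *)

(* Defs.v *)
From mathcomp Require Import all_boot all_order all_algebra.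
From mathcomp Require Import boolp classical_sets reals topology normedtype.

Set Implicit Arguments.
Unset Strict Implicit.
Unset Printing Implicit Defensive.

Import Order.TTheory GRing.Theory Num.Theory.
Import numFieldNormedType.Exports.

Local Open Scope ring_scope.

Record hypergraph (r : nat) : Type := Hypergraph {
  vertex : finType;
  edges : {set {set vertex}};
  edges_card : forall e : {set vertex}, e \in edges -> #|e| = r
}.

(* Not necessarily induced, and up to isomorphism: a copy of F inside H. *)
Definition subgraph (r : nat) (F H : hypergraph r) : Prop :=
  exists f : vertex F -> vertex H,
    injective f /\ forall e, e \in edges F -> f @: e \in edges H.

Definition fam_free (r : nat) (Fam : hypergraph r -> Prop) (H : hypergraph r) : Prop :=
  forall F : hypergraph r, Fam F -> ~ subgraph F H.

Definition shadow_edges (r : nat) (H : hypergraph r) : {set {set vertex H}} :=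
  [set A : {set vertex H} |
     (#|A| == r.-1) && [exists B in edges H, A \subset B]].

Lemma shadow_edges_card (r : nat) (H : hypergraph r) (e : {set vertex H}) :
  e \in shadow_edges H -> #|e| = r.-1.
Proof. by rewrite inE => /andP[/eqP]. Qed.

Definition shadow (r : nat) (H : hypergraph r) : hypergraph r.-1 :=
  Hypergraph (@shadow_edges_card r H).

(* Equal to 0 when H has fewer than r vertices; only the behaviour as the
   number of vertices tends to infinity matters below. *)
Definition density (R : realType) (r : nat) (H : hypergraph r) : R :=
  #|edges H|%:R / 'C(#|vertex H|, r)%:R.

Definition good (R : realType) (r : nat) (H : nat -> hypergraph r) : Prop :=
  [/\ #|vertex (H k)| @[k --> \oo] --> \oo,
      cvg (density R (H k) @[k --> \oo]) &
      cvg (density R (shadow (H k)) @[k --> \oo])]%classic.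

Definition realizes (R : realType) (r : nat) (H : nat -> hypergraph r)
    (x y : R) : Prop :=
  [/\ good R H,
      density R (shadow (H k)) @[k --> \oo] --> x &
      density R (H k) @[k --> \oo] --> y]%classic.

Definition feasible (R : realType) (r : nat) (Fam : hypergraph r -> Prop) :
    set (R * R) :=
  fun p => [/\ 0 <= p.1 <= 1, 0 <= p.2 <= 1 &
    exists H : nat -> hypergraph r,
      (forall k, fam_free Fam (H k)) /\ realizes H p.1 p.2].

Definition proj_feasible (R : realType) (r : nat) (Fam : hypergraph r -> Prop) :
    set R :=
  fun x => exists y : R, feasible Fam (x, y).

(* [is_g Fam x m] reads "g(Fam, x) exists and equals m": m is the maximum,
   attained, of the fibre of the feasible region over x.  A relation is used so
   that no default value is needed where the maximum might not exist. *)
Definition is_g (R : realType) (r : nat) (Fam : hypergraph r -> Prop)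
    (x m : R) : Prop :=
  feasible Fam (x, m) /\ forall y : R, feasible Fam (x, y) -> y <= m.

Definition K43 : hypergraph 3 -> Prop :=
  fun F => (#|edges F| <= 'C(4, 2))%N /\
    exists S : {set vertex F}, #|S| = 4%N /\
      forall u v : vertex F, u \in S -> v \in S -> u != v ->
        exists e : {set vertex F}, [/\ e \in edges F, u \in e & v \in e].

Definition star_edges (n : nat) (u : 'I_n) : {set {set 'I_n}} :=
  [set u |: A | A : {set 'I_n} & (A \subset [set~ u]) && (#|A| == 2%N)].

Lemma star_edges_card (n : nat) (u : 'I_n) (e : {set 'I_n}) :
  e \in star_edges u -> #|e| = 3%N.
Proof.
case/imsetP => A; rewrite inE => /andP[/fintype.subsetP uA /eqP cA] ->.
have uNA : u \notin A by apply/negP => /uA; rewrite !inE eqxx.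
by rewrite cardsU1 uNA cA.
Qed.

Definition star (n : nat) (u : 'I_n) : hypergraph 3 := Hypergraph (@star_edges_card n u).

Definition famD : hypergraph 3 -> Prop :=
  fun F => K43 F /\
    forall (n : nat) (u : 'I_n), (4 <= n)%N -> ~ subgraph F (star u).

(* Main.v *)
Require Import Defs.
From mathcomp Require Import all_boot all_order all_algebra.
From mathcomp Require Import boolp classical_sets reals topology normedtype.
From mathcomp Require Import interval_inference.
From mathcomp Require Import ring lra zify.

Set Implicit Arguments.
Unset Strict Implicit.
Unset Printing Implicit Defensive.

Import Order.TTheory GRing.Theory Num.Theory.
Import numFieldNormedType.Exports.

Local Open Scope ring_scope.

(** Let H be D-free, g the graph of its shadow, and h the graph of heavy pairs,
    those lying in at least two edges of H.  Six edges covering the pairs of a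
    4-set form a member of K_4^3, hence a subgraph of a star, so they have a
    common vertex; exchanging one covering edge for another shows that no K_4
    of g contains a triangle of h.  In particular h is K_4-free, and as the
    light pairs lie in only O(n^2) edges, |H| is at most the number of triangles
    of h up to O(n^2), hence at most n^3/27 + O(n^2).

    If |H| is within 10^-6 n^3 of this bound, h is close to complete 3-partite:
    the common neighbourhoods of the pairs of a suitable triangle are three
    disjoint independent sets covering almost everything.  Colour each vertex by
    a part in which it has few g-neighbours.  A g-edge xy inside a colour class
    forces x and y together to miss n/5 vertices of the other classes, while each
    vertex has at most n/10 g-neighbours of its own colour; so g has at most as
    many edges as a 3-partite graph, |g| <= n^2/3.  Hence a shadow density above
    2/3 forces the edge density down by an absolute constant.  The value 2/9 is
    attained by complete 3-partite 3-graphs, and (x, 0) by stars with isolated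
    vertices added. *)

(** * Triangles in K_4-free graphs *)

Section Counting.
Variables (R : realFieldType) (T : finType).
Implicit Types (P Q : pred T) (h g : rel T).

Definition cnt P : R := \sum_x (P x)%:R.
Definition graph_order : R := #|T|%:R.
Local Notation n := graph_order.

Lemma cnt_ge0 P : 0 <= cnt P.
Proof. by apply: sumr_ge0 => x _; rewrite ler0n. Qed.

Lemma cnt_predT : cnt predT = n.
Proof. by rewrite /cnt sumr_const cardT -cardE. Qed.

Lemma cnt_le P Q : (forall x, P x -> Q x) -> cnt P <= cnt Q.
Proof.
move=> PQ; apply: ler_sum => x _; rewrite ler_nat.
by case: (boolP (P x)) => // /PQ ->.
Qed.

Lemma cnt_pairs P Q : \sum_x \sum_y (P x && Q y)%:R = cnt P * cnt Q.
Proof.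
rewrite /cnt big_distrlr /=; apply: eq_bigr => x _; apply: eq_bigr => y _.
by rewrite -natrM mulnb.
Qed.

Definition miss h P Q : R := \sum_x \sum_y (P x && Q y && ~~ h x y)%:R.

Lemma miss_ge0 h P Q : 0 <= miss h P Q.
Proof. by apply: sumr_ge0 => x _; apply: sumr_ge0 => y _; apply: ler0n. Qed.

Definition deg h x : R := \sum_y (h x y)%:R.
Definition codegree h x y : R := \sum_z (h x z && h y z)%:R.
(* Arcs and triangles are ordered: an edge counts twice, a triangle six times. *)
Definition arcs h : R := \sum_x deg h x.
Definition triangles h : R := \sum_x \sum_y (h x y)%:R * codegree h x y.

Lemma sum_const_R (c : R) : \sum_(x : T) c = c * n.
Proof. by rewrite sumr_const -mulr_natr. Qed.

Definition K4free h := forall x y z w,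
  h x y -> h x z -> h y z -> h x w -> h y w -> h z w -> False.

Section Graph.
Variable h : rel T.
Hypotheses (hsym : symmetric h) (hK4 : K4free h).
Local Notation d := (codegree h).
Let tri x y z : R := (h x y && h x z && h y z)%:R.
Let S2 : R := \sum_x \sum_y (h x y)%:R * (d x y) ^+ 2.

(** A vertex joined to two of [x], [y], [z] is not joined to the third, so the three codegrees count
    it at most once. *)
Lemma codegree_tri x y z : h x y -> h x z -> h y z -> d x y + d x z + d y z <= n.
Proof.
move=> hxy hxz hyz; rewrite /codegree -!big_split -cnt_predT /=.
apply: ler_sum => w _ /=; rewrite -!natrD ler_nat.
have := hK4 hxy hxz hyz (w := w).
by case: (h x w); case: (h y w); case: (h z w) => // /(_ isT isT isT).
Qed.

Let triE : triangles h = \sum_x \sum_y \sum_z tri x y z.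
Proof.
apply: eq_bigr => x _; apply: eq_bigr => y _.
rewrite /codegree mulr_sumr; apply: eq_bigr => z _.
by rewrite /tri -natrM mulnb andbA.
Qed.

(** In each of the three sums, the vertex outside the chosen pair ranges over the common neighbours
    of that pair, which yields a second factor of its codegree. *)
Let S2E : \sum_x \sum_y \sum_z tri x y z * (d x y + d x z + d y z) = 3 * S2.
Proof.
have E1 : \sum_x \sum_y \sum_z tri x y z * d x y = S2.
  apply: eq_bigr => x _; apply: eq_bigr => y _.
  rewrite -mulr_suml expr2 mulrA; congr (_ * _).
  rewrite /codegree mulr_sumr; apply: eq_bigr => z _.
  by rewrite /tri -natrM mulnb andbA.
have E2 : \sum_x \sum_y \sum_z tri x y z * d x z = S2.
  rewrite -E1; apply: eq_bigr => x _; rewrite exchange_big /=.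
  apply: eq_bigr => y _; apply: eq_bigr => z _.
  by rewrite /tri (hsym z y) [h x z && h x y]andbC.
have E3 : \sum_x \sum_y \sum_z tri x y z * d y z = S2.
  rewrite -E1 exchange_big /=; apply: eq_bigr => y _.
  rewrite exchange_big /=; apply: eq_bigr => z _; apply: eq_bigr => x _.
  rewrite /tri (hsym x y) (hsym x z); congr ((nat_of_bool _)%:R * _).
  by rewrite [LHS]andbC andbA.
under eq_bigr => x _ do under eq_bigr => y _ do under eq_bigr => z _ do rewrite !mulrDr.
under eq_bigr => x _ do under eq_bigr => y _ do rewrite !big_split.
under eq_bigr => x _ do rewrite !big_split.
rewrite !big_split /= E1 E2 E3; ring.
Qed.

(* AM-GM: [d ^ 2 >= 2 (n / 3) d - (n / 3) ^ 2], an equality for the balanced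
   complete 3-partite graph, where every codegree is n / 3. *)
Let S2_lb : 2 / 3 * n * triangles h - n ^+ 2 / 9 * arcs h <= S2.
Proof.
rewrite /triangles /arcs /deg !mulr_sumr -sumrB; apply: ler_sum => x _.
rewrite !mulr_sumr -sumrB; apply: ler_sum => y _.
case: (h x y); rewrite ?mul1r ?mul0r ?mulr0 ?mulr1; last by lra.
have := sqr_ge0 (d x y - n / 3); lra.
Qed.

Hypothesis n_gt0 : 0 < n.

Let S2_ub : 3 * S2 <= n * triangles h.
Proof.
rewrite -S2E triE mulr_sumr; apply: ler_sum => x _.
rewrite mulr_sumr; apply: ler_sum => y _.
rewrite mulr_sumr; apply: ler_sum => z _.
rewrite /tri; case: (boolP (h x y && h x z && h y z)) => [/andP[/andP[? ?] ?]|_].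
  by rewrite mul1r mulr1; apply: codegree_tri.
by rewrite mul0r mulr0.
Qed.

Lemma triangles_le_arcs : 3 * triangles h <= n * arcs h.
Proof.
have := S2_ub; have := S2_lb.
move=> lb ub; rewrite -(ler_pM2l n_gt0); lra.
Qed.

Let deg_codegree x y : deg h x + deg h y - n <= codegree h x y.
Proof.
rewrite -cnt_predT lerBlDr -!big_split /=; apply: ler_sum => z _ /=.
by rewrite -!natrD ler_nat; case: (h x z); case: (h y z).
Qed.

Let deg2_sum : \sum_x \sum_y (h x y)%:R * (deg h x + deg h y - n) =
  2 * \sum_x deg h x ^+ 2 - n * arcs h.
Proof.
have E1 : \sum_x \sum_y (h x y)%:R * deg h x = \sum_x deg h x ^+ 2.
  by apply: eq_bigr => x _; rewrite -mulr_suml expr2.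
have E2 : \sum_x \sum_y (h x y)%:R * deg h y = \sum_x deg h x ^+ 2.
  rewrite -E1 exchange_big /=; apply: eq_bigr => x _; apply: eq_bigr => y _.
  by rewrite hsym.
under eq_bigr => x _ do under eq_bigr => y _ do rewrite mulrDr mulrDr.
have E3 : \sum_x \sum_y (h x y)%:R * - n = - n * arcs h.
  by rewrite mulrC mulr_suml; apply: eq_bigr => x _; rewrite mulr_suml.
under eq_bigr => x _ do rewrite !big_split /=.
rewrite !big_split /= E1 E2 E3; ring.
Qed.

Lemma arcs_K4free : 3 * arcs h <= 2 * n ^+ 2.
Proof.
(* Moon-Moser: the codegree of an edge is at least the sum of its degrees minus n. *)
have moon_moser : 2 * \sum_x deg h x ^+ 2 - n * arcs h <= triangles h.
  rewrite -deg2_sum; apply: ler_sum => x _; apply: ler_sum => y _.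
  by rewrite ler_wpM2l ?ler0n.
(* Tangent line of the square at 2n/3, the common degree in the balanced complete 3-partite
   graph. *)
have sq : 4 / 3 * n * arcs h - 4 / 9 * n ^+ 3 <= \sum_x deg h x ^+ 2.
  have -> : 4 / 9 * n ^+ 3 = (\sum_(x : T) 4 / 9 * n ^+ 2).
    by rewrite sum_const_R; ring.
  rewrite mulr_sumr -sumrB; apply: ler_sum => x _.
  have := sqr_ge0 (deg h x - 2 / 3 * n); lra.
have := triangles_le_arcs; move=> tl.
rewrite -(ler_pM2l n_gt0); lra.
Qed.

Lemma triangles_K4free : 9 * triangles h <= 2 * n ^+ 3.
Proof.
have := triangles_le_arcs.
have := arcs_K4free; rewrite -(ler_pM2l n_gt0) => A B; lra.
Qed.

(** Otherwise the factor 1 - 9e enters the upper bound on [S2]. With [S2_lb] and the bound on arcs,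
    (1 + 9e) n t <= 2/9 n^4 for t = [triangles h], whereas (1 + 9e)(2/9 - e) >= 2/9. *)
Lemma exists_rich_triangle (e : R) : 0 <= e -> e <= 1 / 9 ->
  (2 / 9 - e) * n ^+ 3 < triangles h ->
  exists x y z, [/\ h x y, h x z, h y z &
    (1 - 9 * e) * n <= d x y + d x z + d y z].
Proof.
move=> e0 e1 lo.
set good := fun x y z => [&& h x y, h x z, h y z &
  (1 - 9 * e) * n <= d x y + d x z + d y z].
case: (boolP [exists x, exists y, exists z, good x y z]).
  by case/existsP=> x /existsP[y /existsP[z /and4P[? ? ? ?]]]; exists x, y, z.
move=> nex; exfalso.
have le : 3 * S2 <= (1 - 9 * e) * n * triangles h.
  rewrite -S2E triE mulr_sumr; apply: ler_sum => x _.
  rewrite mulr_sumr; apply: ler_sum => y _.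
  rewrite mulr_sumr; apply: ler_sum => z _.
  rewrite /tri; case: (boolP (h x y && h x z && h y z)); last by rewrite mul0r mulr0.
  case/andP => /andP[hxy hxz] hyz; rewrite mul1r mulr1 ltW // ltNge.
  apply/negP => ge; move/negP: nex; apply.
  by apply/existsP; exists x; apply/existsP; exists y; apply/existsP; exists z; apply/and4P.
have lb := S2_lb.
have ub : n ^+ 2 * (3 * arcs h) <= n ^+ 2 * (2 * n ^+ 2).
  by rewrite ler_wpM2l ?sqr_ge0 // arcs_K4free.
have lo' : n * (2 / 9 - e) * n ^+ 3 < n * triangles h.
  by rewrite -mulrA ltr_pM2l.
(* This crude bound suffices for the term 9e n t to make up for the e n^4 lost in the hypothesis. *)
have tn : n ^+ 4 / 9 <= n * triangles h.
  apply: le_trans (ltW lo'); rewrite -subr_ge0.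
  have -> : n * (2 / 9 - e) * n ^+ 3 - n ^+ 4 / 9 = (1 / 9 - e) * n ^+ 4 by ring.
  by rewrite mulr_ge0 ?subr_ge0 // exprn_ge0 // ltW.
have en : e * (n ^+ 4 / 9) <= e * (n * triangles h) by rewrite ler_wpM2l.
lra.
Qed.

(** An arc of [h] joins two different parts or meets the rest, so arcs and missing cross pairs
    together number at most 2(ab + bc + ca) + 2rn^2, and ab + bc + ca <= n^2/3. Only the size of [A]
    is bounded; cyclic permutations give the other two. *)
Lemma three_independent (A B C : pred T) (r s : R) :
  (forall u, [&& ~~ (A u && B u), ~~ (A u && C u) & ~~ (B u && C u)]) ->
  (forall u v, h u v -> [&& ~~ (A u && A v), ~~ (B u && B v) & ~~ (C u && C v)]) ->
  (1 - r) * n <= cnt A + cnt B + cnt C -> (2 / 3 - s) * n ^+ 2 <= arcs h ->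
  s + 2 * r <= 1 / 200 ->
  n / 4 <= cnt A /\
  [/\ miss h A B <= (s + 2 * r) * n ^+ 2, miss h B C <= (s + 2 * r) * n ^+ 2 &
    miss h C A <= (s + 2 * r) * n ^+ 2].
Proof.
move=> disj ind size_ge arcs_ge sr.
pose rest u := ~~ [|| A u, B u | C u].
have cover : cnt A + cnt B + cnt C + cnt rest = n.
  rewrite -cnt_predT -!big_split; apply: eq_bigr => u _ /=.
  rewrite -!natrD /rest; have := disj u.
  by case: (A u); case: (B u); case: (C u).
have bound : arcs h + (miss h A B + miss h B A + miss h B C + miss h C B
    + miss h C A + miss h A C) <=
  (cnt A * cnt B + cnt B * cnt A + cnt B * cnt C + cnt C * cnt B + cnt C * cnt A
    + cnt A * cnt C) + (cnt rest * cnt predT + cnt predT * cnt rest).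
  rewrite -!cnt_pairs -!big_split; apply: ler_sum => u _.
  rewrite -!big_split; apply: ler_sum => v _ /=.
  rewrite -!natrD ler_nat /rest.
  move: (@ind u v) (disj u) (disj v).
  case: (A u); case: (B u); case: (C u) => // + _;
  case: (A v); case: (B v); case: (C v) => // + _;
  by case: (h u v) => // /(_ isT).
have := miss_ge0 h A B; have := miss_ge0 h B A; have := miss_ge0 h B C.
have := miss_ge0 h C B; have := miss_ge0 h C A; have := miss_ge0 h A C.
have := cnt_ge0 rest; have := cnt_ge0 A; have := cnt_ge0 B; have := cnt_ge0 C.
move: size_ge bound arcs_ge cover; rewrite cnt_predT.
move: (miss h A B) (miss h B A) (miss h B C) (miss h C B) (miss h C A) (miss h A C).
move: (arcs h) (cnt A) (cnt B) (cnt C) (cnt rest) => e a b c t m1 m2 m3 m4 m5 m6.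
move=> size_ge bound arcs_ge cover c0 b0 a0 t0 m60 m50 m40 m30 m20 m10.
have tr : n * t <= n * (r * n) by rewrite ler_pM2l //; lra.
have cross : 2 * (a * b + b * c + c * a) >= (2 / 3 - (s + 2 * r)) * n ^+ 2 by lra.
have abc2 : (a + b + c) ^+ 2 <= n ^+ 2.
  by rewrite ler_pXn2r ?nnegrE //; lra.
have cross' : 3 * (a * b + b * c + c * a) <= (a + b + c) ^+ 2.
  have := sqr_ge0 (a - b); have := sqr_ge0 (b - c); have := sqr_ge0 (a - c); lra.
split; last by split; lra.
have sr2 : (s + 2 * r) * n ^+ 2 <= 1 / 200 * n ^+ 2 by rewrite ler_wpM2r ?sqr_ge0.
(* If a < n/4, then 2(ab + bc + ca) is at most (n - a)(n + 3a)/2 < 21/32 n^2, below the required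
   (2/3 - 1/200) n^2. *)
rewrite leNgt; apply/negP => a_lt.
have bc : 4 * (b * c) <= (n - a) ^+ 2.
  have h1 : (b + c) ^+ 2 <= (n - a) ^+ 2.
    by rewrite ler_pXn2r ?nnegrE //; lra.
  have := sqr_ge0 (b - c); lra.
have abac : a * (b + c) <= a * (n - a) by rewrite ler_wpM2l //; lra.
have : 0 <= (n / 4 - a) * (n - a) by rewrite mulr_ge0 //; lra.
have : 0 <= (n / 4 - a) * n by rewrite mulr_ge0 //; lra.
nra.
Qed.

Lemma codegree_cnt x y : codegree h x y = cnt (fun w => h x w && h y w).
Proof. by []. Qed.

(* The parts are the common neighbourhoods of the three pairs of a triangle whose
   codegrees sum to almost n; each is independent since h is K_4-free. *)
Lemma stable_partition (e : R) : 0 <= e -> e <= 1 / 5000 ->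
  (2 / 9 - e) * n ^+ 3 < triangles h ->
  exists A : 'I_3 -> pred T,
  [/\ cnt (fun u => [forall i, ~~ A i u]) <= 9 * e * n,
      forall i j, i != j -> miss h (A i) (A j) <= 21 * e * n ^+ 2 &
      forall i, n / 4 <= cnt (A i)].
Proof.
move=> e0 e1 lo.
have e1' : e <= 1 / 9 by rewrite (le_trans e1) //; lra.
have [x [y [z [hxy hxz hyz rich]]]] := exists_rich_triangle e0 e1' lo.
pose A u := h y u && h z u; pose B u := h x u && h z u; pose C u := h x u && h y u.
have hK := hK4 hxy hxz hyz.
have disj u : [&& ~~ (A u && B u), ~~ (A u && C u) & ~~ (B u && C u)].
  rewrite /A /B /C; have := hK u.
  by case: (h x u); case: (h y u); case: (h z u) => // /(_ isT isT isT).
have ind u v : h u v -> [&& ~~ (A u && A v), ~~ (B u && B v) & ~~ (C u && C v)].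
  move=> huv; rewrite /A /B /C; apply/and3P; split; apply/negP.
  - by case/andP=> /andP[yu zu] /andP[yv zv]; apply: (hK4 hyz yu zu yv zv).
  - by case/andP=> /andP[xu zu] /andP[xv zv]; apply: (hK4 hxz xu zu xv zv).
  - by case/andP=> /andP[xu yu] /andP[xv yv]; apply: (hK4 hxy xu yu xv yv).
have rich' : (1 - 9 * e) * n <= cnt A + cnt B + cnt C.
  by move: rich; rewrite !codegree_cnt; lra.
have arcs_ge : (2 / 3 - 3 * e) * n ^+ 2 <= arcs h.
  by have := triangles_le_arcs => tl; rewrite -(ler_pM2l n_gt0); lra.
(* [three_independent] is applied with s = 3e and r = 9e; here 21e <= 21/5000 < 1/200. *)
have E : 3 * e + 2 * (9 * e) = 21 * e by ring.
have disj' u : [&& ~~ (B u && C u), ~~ (B u && A u) & ~~ (C u && A u)].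
  by have := disj u; case: (A u); case: (B u); case: (C u).
have disj'' u : [&& ~~ (C u && A u), ~~ (C u && B u) & ~~ (A u && B u)].
  by have := disj u; case: (A u); case: (B u); case: (C u).
have ind' u v : h u v -> [&& ~~ (B u && B v), ~~ (C u && C v) & ~~ (A u && A v)].
  by move/ind/and3P=> [-> -> ->].
have ind'' u v : h u v -> [&& ~~ (C u && C v), ~~ (A u && A v) & ~~ (B u && B v)].
  by move/ind/and3P=> [-> -> ->].
have sumBCA : cnt B + cnt C + cnt A = cnt A + cnt B + cnt C by ring.
have sumCAB : cnt C + cnt A + cnt B = cnt A + cnt B + cnt C by ring.
have [cA [mAB mBC mCA]] : n / 4 <= cnt A /\
    [/\ miss h A B <= 21 * e * n ^+ 2, miss h B C <= 21 * e * n ^+ 2 &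
      miss h C A <= 21 * e * n ^+ 2].
  by rewrite -E; apply: three_independent => //; lra.
have [cB _] : n / 4 <= cnt B /\
    [/\ miss h B C <= 21 * e * n ^+ 2, miss h C A <= 21 * e * n ^+ 2 &
      miss h A B <= 21 * e * n ^+ 2].
  by rewrite -E; apply: three_independent; rewrite ?sumBCA //; lra.
have [cC _] : n / 4 <= cnt C /\
    [/\ miss h C A <= 21 * e * n ^+ 2, miss h A B <= 21 * e * n ^+ 2 &
      miss h B C <= 21 * e * n ^+ 2].
  by rewrite -E; apply: three_independent; rewrite ?sumCAB //; lra.
exists (fun i u => nth false [:: A u; B u; C u] i); split.
- pose rest u := ~~ [|| A u, B u | C u].
  have cover : cnt A + cnt B + cnt C + cnt rest = n.
    rewrite -cnt_predT -!big_split; apply: eq_bigr => u _ /=.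
    rewrite -!natrD /rest; have := disj u.
    by case: (A u); case: (B u); case: (C u).
  have : cnt (fun u => [forall i : 'I_3, ~~ nth false [:: A u; B u; C u] i]) <= cnt rest.
    apply: cnt_le => u /forallP al.
    have := al (inord 0); have := al (inord 1); have := al (inord 2).
    by rewrite /rest !inordK //= => /negbTE -> /negbTE -> /negbTE ->.
  by move: rich'; lra.
- have missC P Q : miss h P Q = miss h Q P.
    rewrite /miss exchange_big /=; apply: eq_bigr => v _; apply: eq_bigr => u _.
    by rewrite hsym [P u && _]andbC.
  by case=> [[|[|[|//]]] ?] [[|[|[|//]]] ?] //= _; rewrite ?(missC _ C) // missC.
- by case=> [[|[|[|//]]] ?].
Qed.

End Graph.
End Counting.

(** * Graphs extending a nearly extremal K_4-free graph *)

Section ShadowBound.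
Variables (R : realFieldType) (T : finType).
Variables g h : rel T.
Hypotheses (gsym : symmetric g) (hsym : symmetric h) (hg : subrel h g).
(** For the shadow graph [g] and the heavy pairs [h] of a D-free 3-graph, this and the next
    hypothesis are [no_heavy_triangle_K4] and [few_common_adj]. *)
Hypothesis no_rich_K4 : forall u v w x,
  h u v -> h u w -> h v w -> g u x -> g v x -> g w x -> False.
Hypothesis few_common : forall x y, g x y -> exists z, forall v w,
  g x v -> g y v -> g x w -> g y w -> h v w -> (v == z) || (w == z).
Local Notation n := (graph_order R T).
Local Notation cnt := (@cnt R T).
Local Notation miss := (@miss R T h).

Lemma miss_sub (P Q P' Q' : pred T) : (forall u, P u -> P' u) ->
  (forall u, Q u -> Q' u) -> miss P Q <= miss P' Q'.
Proof.
move=> PP QQ; apply: ler_sum => u _; apply: ler_sum => v _; rewrite ler_nat.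
case: (boolP (P u)) => // /PP ->; case: (boolP (Q v)) => // /QQ ->.
by case: (h u v).
Qed.

(** Every triple of the product contains a pair missing from [h], and a given missing pair lies in
    at most n triples. *)
Lemma triangle_free_parts (P Q S : pred T) :
  (forall u v w, P u -> Q v -> S w -> h u v -> h v w -> h u w -> False) ->
  cnt P * cnt Q * cnt S <= (miss P Q + miss Q S + miss P S) * n.
Proof.
move=> tf.
have E : cnt P * cnt Q * cnt S = \sum_u \sum_v \sum_w (P u && Q v && S w)%:R.
  rewrite -cnt_pairs mulr_suml; apply: eq_bigr => u _.
  rewrite mulr_suml; apply: eq_bigr => v _.
  rewrite mulr_sumr; apply: eq_bigr => w _.
  by rewrite -natrM mulnb.
have E1 : miss P Q * n = \sum_u \sum_v \sum_(w : T) (P u && Q v && ~~ h u v)%:R.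
  rewrite mulr_suml; apply: eq_bigr => u _; rewrite mulr_suml; apply: eq_bigr => v _.
  by rewrite sum_const_R.
have E2 : miss Q S * n = \sum_(u : T) \sum_v \sum_w (Q v && S w && ~~ h v w)%:R.
  by rewrite sum_const_R.
have E3 : miss P S * n = \sum_u \sum_(v : T) \sum_w (P u && S w && ~~ h u w)%:R.
  by rewrite mulr_suml; apply: eq_bigr => u _; rewrite sum_const_R.
rewrite E !mulrDl E1 E2 E3 -!big_split; apply: ler_sum => u _.
rewrite -!big_split; apply: ler_sum => v _; rewrite -!big_split; apply: ler_sum => w _ /=.
rewrite -!natrD ler_nat; move: (@tf u v w).
case: (P u) => //; case: (Q v) => //; case: (S w) => //.
case: (h u v) => //; case: (h v w) => //; case: (h u w) => //.
by move=> /(_ isT isT isT isT isT isT).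
Qed.

(** All pairs of [h] inside the common neighbourhood pass through the vertex [z] of [few_common],
    and at most 2n ordered pairs contain [z]. *)
Lemma common_parts x y (P Q : pred T) : g x y ->
  (forall u, P u -> g x u && g y u) -> (forall u, Q u -> g x u && g y u) ->
  cnt P * cnt Q <= miss P Q + 2 * n.
Proof.
move=> gxy Pxy Qxy; have [z zP] := few_common gxy.
have E1 : n = \sum_(u : T) \sum_v (v == z)%:R.
  rewrite -[LHS]mul1r; rewrite -sum_const_R; apply: eq_bigr => u _.
  by rewrite (bigD1 z) //= eqxx big1 ?addr0 // => v /negbTE ->.
have E2 : n = \sum_u \sum_(v : T) (u == z)%:R by rewrite exchange_big.
have -> : 2 * n = n + n by ring.
rewrite {1}E1 E2 -cnt_pairs -!big_split; apply: ler_sum => u _.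
rewrite -!big_split; apply: ler_sum => v _ /=.
rewrite -!natrD ler_nat.
case: (boolP (P u)) => //= /Pxy/andP[xu yu]; case: (boolP (Q v)) => //= /Qxy/andP[xv yv].
case: (boolP (h u v)) => //= huv.
by case/orP: (zP u v xu yu xv yv huv) => ->; rewrite ?addn1.
Qed.

(** * Colouring the larger graph by a near 3-partition of the smaller one *)

Section Partition.
Hypothesis n_large : 20 * 1000 <= n.
Variable A : 'I_3 -> pred T.
Variable e : R.
Hypothesis e_small : e <= 1 / 1000 / 1000.
Hypothesis A_cover : cnt (fun u => [forall i, ~~ A i u]) <= 9 * e * n.
Hypothesis A_miss : forall i j, i != j -> miss (A i) (A j) <= 21 * e * n ^+ 2.
Hypothesis A_size : forall i, n / 4 <= cnt (A i).

Let n_gt0 : 0 < n. Proof. by move: n_large; lra. Qed.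

(** With more than n/20 neighbours of [x] in every part, the few missing pairs of [h] would leave a
    triangle of [h] among them, forming with [x] a forbidden K_4 of [g]. *)
Lemma missing_part x : exists i, cnt (fun u => A i u && g x u) <= n / 20.
Proof.
case: (boolP [exists i, cnt (fun u => A i u && g x u) <= n / 20]) => [/existsP //|].
move=> /existsPn big; exfalso.
pose N (i : 'I_3) u := A i u && g x u.
have bigN i : n / 20 < cnt (N i) by rewrite ltNge big.
have missN i j : i != j -> miss (N i) (N j) <= 21 * e * n ^+ 2.
  by move=> /A_miss; apply: le_trans; apply: miss_sub => u /andP[].
pose i0 : 'I_3 := inord 0; pose i1 : 'I_3 := inord 1; pose i2 : 'I_3 := inord 2.
have tf u v w : N i0 u -> N i1 v -> N i2 w -> h u v -> h v w -> h u w -> False.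
  rewrite /N !(gsym x) => /andP[_ xu] /andP[_ xv] /andP[_ xw] huv hvw huw.
  exact: (no_rich_K4 huv huw hvw xu xv xw).
have := triangle_free_parts tf.
have neq (a b : nat) : (a < 3)%N -> (b < 3)%N -> a != b -> inord a != inord b :> 'I_3.
  by move=> a3 b3; apply: contraNneq => /(congr1 val) /=; rewrite !inordK // => ->.
have := missN i0 i1 (neq 0 1 isT isT isT); have := missN i1 i2 (neq 1 2 isT isT isT).
have := missN i0 i2 (neq 0 2 isT isT isT).
move: (bigN i0) (bigN i1) (bigN i2).
move: (cnt (N i0)) (cnt (N i1)) (cnt (N i2)) (miss _ _) (miss _ _) (miss _ _).
move=> a b c m1 m2 m3 a_gt b_gt c_gt le1 le2 le3 le.
have n20 : 0 < n / 20 by rewrite divr_gt0.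
have lo : (n / 20) ^+ 3 < a * b * c.
  rewrite exprS expr2 mulrA; apply: ltr_pM => //; try exact: ltW.
    by rewrite mulr_ge0 ?ltW.
  by apply: ltr_pM => //; apply: ltW.
(* At most 63e n^3 triples meet a missing pair, and 63/10^6 < 1/20^3. *)
have up : (m3 + m2 + m1) * n <= 63 * e * n ^+ 3.
  have -> : 63 * e * n ^+ 3 = (63 * e * n ^+ 2) * n by ring.
  by rewrite ler_wpM2r ?(ltW n_gt0) //; lra.
have en : e * n ^+ 3 <= 1 / 1000 / 1000 * n ^+ 3 by rewrite ler_wpM2r // exprn_ge0 // ltW.
have n3 : 0 < n ^+ 3 by rewrite exprn_gt0.
lra.
Qed.

Section Coloring.
Variable c : T -> 'I_3.
Hypothesis c_missing : forall x, cnt (fun u => A (c x) u && g x u) <= n / 20.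

(* Such a v has at most n / 20 neighbours in A_j, so it misses n / 5 of A_j. *)
Lemma misplaced i j : i != j -> cnt (fun v => A i v && (c v == j)) <= 105 * e * n.
Proof.
move=> neq_ij.
have : cnt (fun v => A i v && (c v == j)) * (n / 5) <= miss (A i) (A j).
  rewrite mulr_suml; apply: ler_sum => v _.
  case: (boolP (A i v)) => [Aiv|_] /=; last first.
    by rewrite mul0r sumr_ge0 // => u _; rewrite ler0n.
  case: eqP => [cv|_] /=; last by rewrite mul0r sumr_ge0 // => u _; rewrite ler0n.
  rewrite mul1r -/(cnt (fun u => A j u && ~~ h v u)).
  have : cnt (A j) <= cnt (fun u => A j u && ~~ h v u) + cnt (fun u => A (c v) u && g v u).
    rewrite -big_split; apply: ler_sum => u _ /=; rewrite -natrD ler_nat cv.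
    by move: (@hg v u); case: (A j u); case: (h v u) => // ->.
  have := c_missing v; have := A_size j; lra.
have := A_miss neq_ij => m1 m2.
rewrite -(ler_pM2r (_ : 0 < n / 5)) ?divr_gt0 //.
have -> : 105 * e * n * (n / 5) = 21 * e * n ^+ 2 by field.
exact: le_trans m2 m1.
Qed.

(** Compared with the complete 3-partite graph of the colouring, [g] gains the pairs of [B] and
    loses those of [M]. *)
Let B x y := g x y && (c x == c y).
Let M x y := (c x != c y) && ~~ g x y.

(** A neighbour of colour i = [c x] lies in part i (at most n/20 of them, by the choice of colour),
    in no part, or in another part and is then misplaced; the last two kinds number at most 219e
    n. *)
Lemma inside_degree x : cnt (B x) <= n / 10.
Proof.
pose i := c x.
have : cnt (B x) <= cnt (fun u => A i u && g x u) + cnt (fun u => [forall i, ~~ A i u])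
   + (cnt (fun u => A (i + 1) u && (c u == i)) + cnt (fun u => A (i + 2) u && (c u == i))).
  rewrite -!big_split; apply: ler_sum => u _ /=; rewrite -!natrD ler_nat /B -/i eq_sym.
  case: (c u == i); rewrite ?andbF //= !andbT.
  case: (g x u) => //=; rewrite andbT.
  case: (boolP [forall i, _]) => [_|/forallPn[j]]; first by rewrite addn1 addSn.
  rewrite negbK => Aj.
  (* Addition in ['I_3] is modulo 3, so [i + 1] and [i + 2] are the two other indices. *)
  have : [|| j == i, j == i + 1 | j == i + 2].
    by clear; case: i j => [[|[|[|//]]] ?] [[|[|[|//]]] ?].
  by case/or3P=> /eqP ji; move: Aj; rewrite ji => ->;
    rewrite ?add1n ?addSn ?addnS.
have d1 : i + 1 != i by clear; case: i => [[|[|[|//]]] ?].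
have d2 : i + 2 != i by clear; case: i => [[|[|[|//]]] ?].
have := misplaced d1; have := misplaced d2; have := c_missing x.
have := A_cover.
have en : e * n <= 1 / 1000 / 1000 * n by rewrite ler_wpM2r // ltW.
by have := n_gt0; rewrite -/i; lra.
Qed.

(** Some part j other than i = [c x] contains at most n/50 common neighbours of [x] and [y]. Apart
    from these and the misplaced vertices, each of its n/4 vertices has a colour other than i and is
    missed by [x] or [y]. *)
Lemma outside_missing x y : B x y -> n / 5 <= cnt (M x) + cnt (M y).
Proof.
case/andP=> gxy /eqP cxy; pose i := c x.
pose X j u := A j u && (g x u && g y u).
(* Two parts with more than n/50 common neighbours each would contradict [common_parts]: n^2/2500
   exceeds 21e n^2 + 2n, since 2n <= n^2/10^4. *)
have small j k : j != k -> cnt (X j) <= n / 50 \/ cnt (X k) <= n / 50.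
  move=> jk; case: (lerP (cnt (X j)) (n / 50)) => [|lj]; first by left.
  case: (lerP (cnt (X k)) (n / 50)) => [|lk]; [by right|exfalso].
  have : cnt (X j) * cnt (X k) <= miss (X j) (X k) + 2 * n.
    by apply: (common_parts gxy) => u /andP[].
  have : miss (X j) (X k) <= 21 * e * n ^+ 2.
    by apply: le_trans (A_miss jk); apply: miss_sub => u /andP[].
  have n50 : 0 <= n / 50 by rewrite divr_ge0 ?ltW.
  have : (n / 50) * (n / 50) < cnt (X j) * cnt (X k) by apply: ltr_pM.
  have en : e * n ^+ 2 <= 1 / 1000 / 1000 * n ^+ 2 by rewrite ler_wpM2r // sqr_ge0.
  have : 20 * 1000 * n <= n ^+ 2 by rewrite expr2 ler_wpM2r // ltW.
  have : 0 < n ^+ 2 by rewrite exprn_gt0.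
  lra.
have main j : j != i -> cnt (X j) <= n / 50 -> n / 5 <= cnt (M x) + cnt (M y).
  move=> ji Xj.
  have : cnt (A j) <= cnt (X j) + cnt (fun v => A j v && (c v == i)) + cnt (M x) + cnt (M y).
    rewrite -!big_split; apply: ler_sum => u _ /=; rewrite -!natrD ler_nat /X /M -cxy -/i.
    rewrite (eq_sym i).
    by case: (A j u); case: (c u == i); case: (g x u); case: (g y u).
  have := misplaced ji; have := A_size j; have := n_gt0.
  have en : e * n <= 1 / 1000 / 1000 * n by rewrite ler_wpM2r // ltW.
  lra.
have d1 : i + 1 != i by clear; case: i => [[|[|[|//]]] ?].
have d2 : i + 2 != i by clear; case: i => [[|[|[|//]]] ?].
have d3 : i + 1 != i + 2 by clear; case: i => [[|[|[|//]]] ?].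
by case: (small _ _ d3); apply: main.
Qed.

(** Summing [outside_missing] over [B] gives (n/5)|B| at most twice the sum of
    [cnt (B x) * cnt (M x)], hence at most 2(n/10)|M| by [inside_degree]. So |B| <= |M|, and [g] has
    no more arcs than a complete 3-partite graph. *)
Lemma arcs_coloring : 3 * arcs R g <= 2 * n ^+ 2.
Proof.
have BM : arcs R B <= arcs R M.
  have le1 : arcs R B * (n / 5) <= \sum_x \sum_y (B x y)%:R * (cnt (M x) + cnt (M y)).
    rewrite mulr_suml; apply: ler_sum => x _; rewrite mulr_suml; apply: ler_sum => y _.
    by case: (boolP (B x y)) => [/outside_missing ?|_]; rewrite ?mul1r // !mul0r.
  have E1 : \sum_x \sum_y (B x y)%:R * cnt (M x) = \sum_x cnt (B x) * cnt (M x).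
    by apply: eq_bigr => x _; rewrite mulr_suml.
  have E2 : \sum_x \sum_y (B x y)%:R * cnt (M y) = \sum_x cnt (B x) * cnt (M x).
    rewrite -E1 exchange_big /=; apply: eq_bigr => x _; apply: eq_bigr => y _.
    by rewrite /B gsym eq_sym.
  have E3 : \sum_x \sum_y (B x y)%:R * (cnt (M x) + cnt (M y)) =
      2 * \sum_x cnt (B x) * cnt (M x).
    under eq_bigr => x _ do under eq_bigr => y _ do rewrite mulrDr.
    under eq_bigr => x _ do rewrite big_split /=.
    by rewrite big_split /= E1 E2; ring.
  have le2 : \sum_x cnt (B x) * cnt (M x) <= n / 10 * arcs R M.
    rewrite mulr_sumr; apply: ler_sum => x _; rewrite ler_wpM2r ?cnt_ge0 //.
    exact: inside_degree.
  rewrite -(ler_pM2r (_ : 0 < n / 5)) ?divr_gt0 //; lra.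
have split_g : arcs R g + arcs R M = arcs R B + \sum_x \sum_y (c x != c y)%:R.
  rewrite -!big_split; apply: eq_bigr => x _; rewrite -!big_split; apply: eq_bigr => y _.
  by rewrite /= -!natrD /B /M; case: (g x y); case: (c x == c y).
pose v i := cnt (fun x => c x == i).
have vn : \sum_i v i = n.
  rewrite exchange_big /= -cnt_predT; apply: eq_bigr => x _ /=.
  by rewrite (bigD1 (c x)) //= eqxx big1 ?addr0 // => i; rewrite eq_sym => /negbTE ->.
have same : \sum_x \sum_y (c x != c y)%:R + \sum_i v i ^+ 2 = n ^+ 2.
  have -> : \sum_i v i ^+ 2 = \sum_x \sum_y (c x == c y)%:R.
    under eq_bigr => i _ do rewrite expr2 -cnt_pairs.
    rewrite exchange_big; apply: eq_bigr => x _ /=; rewrite exchange_big.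
    apply: eq_bigr => y _ /=.
    rewrite (bigD1 (c x)) //= eqxx big1 ?addr0 /= 1?[c y == _]eq_sym // => i.
    by rewrite eq_sym => /negbTE ->.
  rewrite -big_split expr2 -{1}cnt_predT mulr_suml; apply: eq_bigr => x _ /=.
  rewrite -big_split mul1r -cnt_predT; apply: eq_bigr => y _ /=.
  by rewrite -natrD; case: (c x == c y).
have sq : n ^+ 2 <= 3 * \sum_i v i ^+ 2.
  rewrite -vn !big_ord_recl !big_ord0.
  move: (v _) (v _) (v _) => p q r.
  have := sqr_ge0 (p - q); have := sqr_ge0 (q - r); have := sqr_ge0 (p - r); lra.
lra.
Qed.

End Coloring.

End Partition.

Lemma K4free_heavy : K4free h.
Proof.
move=> x y z w xy xz yz xw yw zw.
exact: (no_rich_K4 xy xz yz (hg xw) (hg yw) (hg zw)).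
Qed.

Lemma arcs_of_many_triangles : 20 * 1000 <= n ->
  (2 / 9 - 1 / 1000 / 1000) * n ^+ 3 < triangles R h -> 3 * arcs R g <= 2 * n ^+ 2.
Proof.
move=> n_large many.
have n_gt0 : 0 < n by lra.
have e0 : 0 <= 1 / 1000 / 1000 :> R by lra.
have e1 : 1 / 1000 / 1000 <= 1 / 5000 :> R by lra.
have [A [cover mis size]] := stable_partition hsym K4free_heavy n_gt0 e0 e1 many.
have [c cP] := fin_all_exists (missing_part n_large (lexx _) mis).
exact: (arcs_coloring n_large (lexx _) cover mis size cP).
Qed.

End ShadowBound.

(** * Heavy pairs of a D-free 3-graph *)

Section Starlike.
Variables (T : finType) (E : {set {set T}}).
Local Open Scope nat_scope.

Definition pair_degree x y := #|[set e in E | (x \in e) && (y \in e)]|.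
Definition adj x y := (x != y) && (0 < pair_degree x y).
Definition heavy x y := (x != y) && (1 < pair_degree x y).

(* The edges cover the pairs ab, ac, ad, bc, bd, cd in this order. *)
Definition starlike := forall a b c d (e1 e2 e3 e4 e5 e6 : {set T}),
  uniq [:: a; b; c; d] -> all (mem E) [:: e1; e2; e3; e4; e5; e6] ->
  [/\ a \in e1, b \in e1, a \in e2, c \in e2 & a \in e3] ->
  [/\ d \in e3, b \in e4, c \in e4, b \in e5 & d \in e5] ->
  c \in e6 -> d \in e6 ->
  exists w, all (fun e : {set T} => w \in e) [:: e1; e2; e3; e4; e5; e6].

Lemma pair_degree_sym x y : pair_degree x y = pair_degree y x.
Proof. by apply: eq_card => e; rewrite !inE [(x \in e) && _]andbC. Qed.

Lemma adj_sym : symmetric adj.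
Proof. by move=> x y; rewrite /adj eq_sym pair_degree_sym. Qed.

Lemma heavy_sym : symmetric heavy.
Proof. by move=> x y; rewrite /heavy eq_sym pair_degree_sym. Qed.

Lemma heavy_adj : subrel heavy adj.
Proof. by move=> x y /andP[xy /ltnW d]; apply/andP. Qed.

Lemma adjP x y : adj x y -> x != y /\ exists e, [/\ e \in E, x \in e & y \in e].
Proof.
case/andP=> xy /card_gt0P[e]; rewrite inE => /and3P[eE xe ye].
by split=> //; exists e.
Qed.

Hypothesis E3 : forall e, e \in E -> #|e| = 3.

Lemma edge_eq e a b c : e \in E -> a \in e -> b \in e -> c \in e ->
  uniq [:: a; b; c] -> e = [set a; b; c].
Proof.
move=> eE ae be ce abc; apply/esym/eqP.
have -> : [set a; b; c] = [set x in [:: a; b; c]].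
  by apply/setP => x; rewrite !inE orbA.
rewrite eqEcard cardsE (card_uniqP abc) /= (E3 eE) leqnn andbT.
by apply/fintype.subsetP => x; rewrite !inE => /or3P[] /eqP->.
Qed.

(** At most one edge contains all of [u], [v], [p], so one of two edges through [u] and [v] avoids
    [p]. *)
Lemma heavy_avoid u v p : heavy u v -> p != u -> p != v ->
  exists e, [/\ e \in E, u \in e, v \in e & p \notin e].
Proof.
case/andP=> uv /card_gt1P[e1 [e2 []]]; rewrite !inE.
move=> /and3P[e1E u1 v1] /and3P[e2E u2 v2] ne pu pv.
case: (boolP (p \in e1)) => [p1|?]; last by exists e1.
case: (boolP (p \in e2)) => [p2|?]; last by exists e2.
have upv : uniq [:: u; v; p] by rewrite /= !inE negb_or uv (eq_sym u) pu (eq_sym v) pv.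
by rewrite (edge_eq e1E u1 v1 p1 upv) (edge_eq e2E u2 v2 p2 upv) eqxx in ne.
Qed.

Hypothesis stE : starlike.

(** The edges xuv and xuw share only x and u. Covering uv by an edge that avoids x and vw by one
    that avoids u leaves no common vertex. *)
Lemma no_two_fans u v w x e1 e2 : uniq [:: x; u; v; w] -> e1 \in E -> e2 \in E ->
  heavy u v -> heavy v w ->
  x \in e1 -> u \in e1 -> v \in e1 -> x \in e2 -> u \in e2 -> w \in e2 -> False.
Proof.
move=> un e1E e2E huv hvw x1 u1 v1 x2 u2 w2.
move: (un); rewrite /= !inE !negb_or => /and4P[/and3P[xu xv xw] /andP[uv uw] vw _].
have [f [fE uf vf xf]] := heavy_avoid huv xu xv.
have [f' [f'E vf' wf' uf']] := heavy_avoid hvw uv uw.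
have := @stE x u v w e1 e1 e2 f e2 f' un.
rewrite /= e1E e2E fE f'E => /(_ isT).
case=> // q /= /and5P[q1 _ q2 qf /andP[_ /andP[qf' _]]].
move: q1; rewrite (edge_eq e1E x1 u1 v1) ?inE; last first.
  by rewrite /= !inE negb_or xu xv uv.
case/orP=> [/orP[]|] /eqP qE; [by rewrite -qE qf in xf|by rewrite -qE qf' in uf'|].
move: q2; rewrite (edge_eq e2E x2 u2 w2) ?inE; last first.
  by rewrite /= !inE negb_or xu xw uw.
by rewrite qE (eq_sym v x) (negbTE xv) (eq_sym v u) (negbTE uv) (negbTE vw).
Qed.

(** The four edges are all the triples of a 4-set, which cover its pairs and have no common
    vertex. *)
Lemma no_crossed_fans x y v w fx fy e1 e2 : uniq [:: x; y; v; w] ->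
  all (mem E) [:: fx; fy; e1; e2] ->
  [/\ v \in fx, w \in fx & x \in fx] -> [/\ v \in fy, w \in fy & y \in fy] ->
  [/\ x \in e1, y \in e1 & v \in e1] -> [/\ x \in e2, y \in e2 & w \in e2] -> False.
Proof.
move=> un /= /and5P[fxE fyE e1E e2E _] [vx wx xx] [vy wy yy] [x1 y1 v1] [x2 y2 w2].
move: (un); rewrite /= !inE !negb_or => /and4P[/and3P[xy xv xw] /andP[yv yw] vw _].
have := @stE x y v w e1 e1 e2 e1 fy fx un.
rewrite /= e1E e2E fyE fxE => /(_ isT); case=> // q /= /and5P[q1 _ q2 _ /and3P[qy qx _]].
move: q1; rewrite (edge_eq e1E x1 y1 v1) ?inE; last first.
  by rewrite /= !inE negb_or xy xv yv.
case/orP=> [/orP[]|] /eqP qE.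
- move: qy; rewrite qE (edge_eq fyE vy wy yy) ?inE ?(negbTE xv) ?(negbTE xw) ?(negbTE xy) //.
  by rewrite /= !inE negb_or vw (eq_sym v) yv (eq_sym w) yw.
- move: qx; rewrite qE (edge_eq fxE vx wx xx) ?inE ?(negbTE yv) ?(negbTE yw)
    ?(eq_sym y) ?(negbTE xy) //.
  by rewrite /= !inE negb_or vw (eq_sym v) xv (eq_sym w) xw.
- move: q2; rewrite (edge_eq e2E x2 y2 w2) ?inE; last first.
    by rewrite /= !inE negb_or xy xw yw.
  by rewrite qE (eq_sym v x) (negbTE xv) (eq_sym v y) (negbTE yv) (negbTE vw).
Qed.

(** If [e] avoids [v] and [w], covering vw by either of two edges [f], [f'] gives common vertices
    [p] in [f] and [p'] in [f'], both in [e]. They differ because [f] and [f'] do, so the edges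
    chosen through xv and yv both equal {v, p, p'}. Hence {p, p'} = {x, y}, and all four triples on
    x, y, v, w are edges, against [no_crossed_fans]. *)
Lemma edge_meets_heavy x y v w e : adj x v -> adj x w -> adj y v -> adj y w ->
  heavy v w -> x != y -> e \in E -> x \in e -> y \in e -> (v \in e) || (w \in e).
Proof.
move=> /adjP[xv [exv [exvE x1 v1]]] /adjP[xw [exw [exwE x2 w2]]].
move=> /adjP[yv [eyv [eyvE y3 v3]]] /adjP[yw [eyw [eywE y4 w4]]].
move=> /andP[vw /card_gt1P[f [f' []]]]; rewrite !inE.
move=> /and3P[fE vf wf] /and3P[f'E vf' wf'] ff' xy eE xe ye.
apply/negP => /negP; rewrite negb_or => /andP[ve we].
have un : uniq [:: x; y; v; w] by rewrite /= !inE !negb_or xy xv xw yv yw vw.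
have := @stE x y v w e exv exw eyv eyw f un.
rewrite /= eE exvE exwE eyvE eywE fE => /(_ isT); case=> // p.
move=> /= /and5P[pe p1 p2 p3 /and3P[p4 pf _]].
have := @stE x y v w e exv exw eyv eyw f' un.
rewrite /= eE exvE exwE eyvE eywE f'E => /(_ isT); case=> // p'.
move=> /= /and5P[pe' p1' p2' p3' /and3P[p4' pf' _]].
have pv : p != v by apply: contraNneq ve => <-.
have pw : p != w by apply: contraNneq we => <-.
have pv' : p' != v by apply: contraNneq ve => <-.
have pw' : p' != w by apply: contraNneq we => <-.
have pp' : p != p'.
  apply: contraNneq ff' => E0; rewrite -E0 in pf'.
  have u3 : uniq [:: v; w; p] by rewrite /= !inE negb_or vw (eq_sym v) pv (eq_sym w) pw.
  by rewrite (edge_eq fE vf wf pf u3) (edge_eq f'E vf' wf' pf' u3).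
have u3 : uniq [:: v; p; p'] by rewrite /= !inE negb_or (eq_sym v) pv (eq_sym v) pv' pp'.
have xp : (p == x) || (p' == x).
  move: x1; rewrite (edge_eq exvE v1 p1 p1' u3) !inE (negbTE xv) /=.
  by rewrite !(eq_sym x).
have yp : (p == y) || (p' == y).
  move: y3; rewrite (edge_eq eyvE v3 p3 p3' u3) !inE (negbTE yv) /=.
  by rewrite !(eq_sym y).
case/orP: xp => /eqP xp; case/orP: yp => /eqP yp.
- by rewrite -xp -yp eqxx in xy.
- subst x y; apply: (@no_crossed_fans p p' v w f f' exv exw) => //=.
  by rewrite fE f'E exvE exwE.
- subst x y; apply: (@no_crossed_fans p' p v w f' f exv exw) => //=.
  by rewrite fE f'E exvE exwE.
- by rewrite -xp -yp eqxx in xy.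
Qed.

(** By [edge_meets_heavy], each edge chosen through [x] consists of [x] and two of [u], [v], [w].
    The three edges together reach all of [u], [v], [w], so two of them are distinct; these share a
    second vertex, which [no_two_fans] forbids. *)
Lemma no_heavy_triangle_K4 u v w x : heavy u v -> heavy u w -> heavy v w ->
  adj u x -> adj v x -> adj w x -> False.
Proof.
move=> huv huw hvw; rewrite !(adj_sym _ x) => ux vx wx.
have [xu [e1 [e1E x1 u1]]] := adjP ux.
have [xv [e2 [e2E x2 v2]]] := adjP vx.
have [xw [e3 [e3E x3 w3]]] := adjP wx.
have [uv _] := andP huv; have [uw _] := andP huw; have [vw _] := andP hvw.
have hvu : heavy v u by rewrite heavy_sym.
have hwu : heavy w u by rewrite heavy_sym.
have hwv : heavy w v by rewrite heavy_sym.
have un1 : uniq [:: x; u; v; w] by rewrite /= !inE !negb_or xu xv xw uv uw vw.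
have un2 : uniq [:: x; v; u; w].
  by rewrite /= !inE !negb_or xu xv xw (eq_sym v) uv uw vw.
have un3 : uniq [:: x; w; u; v].
  by rewrite /= !inE !negb_or xu xv xw (eq_sym w) uw uv (eq_sym w) vw.
have := edge_meets_heavy vx wx (heavy_adj huv) (heavy_adj huw) hvw xu e1E x1 u1.
have := edge_meets_heavy ux wx (heavy_adj hvu) (heavy_adj hvw) huw xv e2E x2 v2.
have := edge_meets_heavy ux vx (heavy_adj hwu) (heavy_adj hwv) huv xw e3E x3 w3.
case/orP=> m3; case/orP=> m2; case/orP=> m1;
  by [ exact: (no_two_fans un1 _ _ huv hvw x1 u1 m1 x3 m3 w3)
     | exact: (no_two_fans un1 _ _ huv hvw x2 m2 v2 x3 m3 w3)
     | exact: (no_two_fans un1 _ _ huv hvw x2 m2 v2 x1 u1 m1)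
     | exact: (no_two_fans un2 _ _ hvu huw x1 m1 u1 x3 m3 w3)
     | exact: (no_two_fans un2 _ _ hvu huw x1 m1 u1 x2 v2 m2)
     | exact: (no_two_fans un2 _ _ hvu huw x2 v2 m2 x3 m3 w3)
     | exact: (no_two_fans un3 _ _ hwu huv x1 m1 u1 x3 w3 m3)
     | exact: (no_two_fans un3 _ _ hwu huv x1 m1 u1 x2 m2 v2)
     | exact: (no_two_fans un3 _ _ hwu huv x3 w3 m3 x2 m2 v2) ].
Qed.

(* The vertex z is the third vertex of any edge through x and y. *)
Lemma few_common_adj x y : adj x y -> exists z, forall v w,
  adj x v -> adj y v -> adj x w -> adj y w -> heavy v w -> (v == z) || (w == z).
Proof.
move=> /adjP[xy [e [eE xe ye]]].
have : 0 < #|e :\ x :\ y|.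
  have := E3 eE; rewrite (cardsD1 x) xe (cardsD1 y) !inE eq_sym xy ye; lia.
case/card_gt0P=> z; rewrite !inE => /and3P[zy zx ze].
exists z => v w xv yv xw yw hvw.
have := edge_meets_heavy xv xw yv yw hvw xy eE xe ye.
have u3 : uniq [:: x; y; z] by rewrite /= !inE negb_or xy (eq_sym x) zx (eq_sym y) zy.
rewrite (edge_eq eE xe ye ze u3) !inE.
case/adjP: xv => xv _; case/adjP: yv => yv _; case/adjP: xw => xw _; case/adjP: yw => yw _.
by rewrite (eq_sym v x) (negbTE xv) (eq_sym v y) (negbTE yv)
  (eq_sym w x) (negbTE xw) (eq_sym w y) (negbTE yw).
Qed.

End Starlike.

(** * Counting edges through pairs *)

Section PairCounting.
Local Open Scope nat_scope.
Variable T : finType.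

(** Double counting of ordered pairs inside edges; used with r = 2 for the shadow and r = 3 for the
    edges with all pairs heavy. *)
Lemma sum_pair_degree (r : nat) (E : {set {set T}}) : (forall e, e \in E -> #|e| = r) ->
  \sum_x \sum_y (x != y) * pair_degree E x y = #|E| * (r * r.-1).
Proof.
move=> Er.
have dE x y : (x != y) * pair_degree E x y =
    \sum_(e in E) ((x \in e) && (y \in e :\ x)).
  rewrite /pair_degree -sum1_card big_distrr /=.
  rewrite (eq_bigl (fun e => (e \in E) && ((x \in e) && (y \in e)))); last first.
    by move=> e; rewrite inE.
  rewrite big_mkcondr; apply: eq_bigr => e _ /=.
  by rewrite !inE (eq_sym y); case: (x \in e); case: (y \in e); case: (x == y).
under eq_bigr => x _ do under eq_bigr => y _ do rewrite dE.
under eq_bigr => x _ do rewrite exchange_big.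
rewrite exchange_big /= -sum_nat_const; apply: eq_bigr => e eE.
rewrite -{1}(Er e eE) -sum_nat_const [RHS]big_mkcond; apply: eq_bigr => x _ /=.
case: (boolP (x \in e)) => [xe|_] /=; last by rewrite big1.
rewrite -(Er e eE) (cardsD1 x) xe -sum1_card [RHS]big_mkcond /=.
by apply: eq_bigr => y _; case: (y \in _).
Qed.

Lemma pair_set_eq (e : {set T}) x y : #|e| = 2 -> x \in e -> y \in e -> x != y ->
  e = [set x; y].
Proof.
move=> e2 xe ye xy; apply/esym/eqP; rewrite eqEcard cards2 xy e2 leqnn andbT.
by apply/fintype.subsetP => z; rewrite !inE => /orP[] /eqP->.
Qed.

Lemma shadow_adj (H : hypergraph 3) x y : x != y ->
  ([set x; y] \in shadow_edges H) = adj (edges H) x y.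
Proof.
move=> xy; rewrite inE cards2 xy eqxx /= /adj xy /=.
apply/existsP/card_gt0P => [] [e].
  by case/andP=> eH /fintype.subsetP s; exists e; rewrite !inE eH !s ?inE ?eqxx ?orbT.
rewrite inE => /and3P[eH xe ye]; exists e; rewrite eH.
by apply/fintype.subsetP => z; rewrite !inE => /orP[] /eqP->.
Qed.
End PairCounting.

Lemma shadow_arcs (R : realFieldType) (H : hypergraph 3) :
  2 * #|shadow_edges H|%:R = arcs R (adj (edges H)).
Proof.
have := sum_pair_degree (@shadow_edges_card 3 H); rewrite /= => E.
rewrite mulrC -[2 in LHS]/((2 * 1)%N%:R) -natrM -E natr_sum; apply: eq_bigr => x _.
rewrite natr_sum; apply: eq_bigr => y _; congr _%:R.
have [->|xy] := eqVneq x y; first by rewrite /adj eqxx.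
rewrite mul1n -shadow_adj // /pair_degree.
case: (boolP (_ \in shadow_edges H)) => sH.
  apply/eqP/cards1P; exists [set x; y]; apply/setP => e; rewrite !inE -/(shadow_edges H).
  apply/idP/eqP => [/and3P[eS xe ye]|->].
    by apply: pair_set_eq; rewrite // (shadow_edges_card (r := 3) (H := H)) // inE.
  by rewrite !inE in sH *; rewrite sH !eqxx orbT.
apply: eq_card0 => e; apply/negP; rewrite inE => /and3P[eS xe ye].
by case/negP: sH; rewrite -(pair_set_eq (shadow_edges_card eS) xe ye xy).
Qed.

(** * Edges against triangles of heavy pairs *)

Section TripleCounting.
Variables (R : realFieldType) (T : finType) (E : {set {set T}}).
Hypothesis E3 : forall e, e \in E -> #|e| = 3%N.

Let E' := [set e in E | [forall x in e, forall y in e, (x != y) ==> heavy E x y]].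

(** An edge outside [E'] contains a light pair and is the only edge through it, so it is determined
    by that pair. [F] sends a pair in no edge to the empty set, which can only enlarge the image. *)
Let light_edges : (#|E :\: E'| <= #|T| ^ 2)%N.
Proof.
pose F (p : T * T) := odflt finset.set0 [pick e in E | (p.1 \in e) && (p.2 \in e)].
apply: leq_trans (_ : #|[set F p | p : T * T]| <= _)%N; last first.
  by rewrite (leq_trans (leq_imset_card _ _)) // -mulnn -card_prod; apply/eq_leq/eq_card.
apply: subset_leq_card; apply/fintype.subsetP => e; rewrite !inE.
case/andP=> + eE; rewrite eE /= => /forallPn[x]; rewrite negb_imply => /andP[xe].
case/forallPn=> y; rewrite !negb_imply => /and3P[ye xy]; rewrite /heavy xy /= -leqNgt => le1.
apply/imsetP; exists (x, y) => //; rewrite /F /=.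
case: pickP => [f /and3P[fE xf yf]|/(_ e)]; last by rewrite eE xe ye.
apply: (card_le1_eqP le1) => //=; by rewrite !inE ?eE ?fE ?xe ?xf.
Qed.

(** For each ordered pair, the edges of [E'] through it are determined by their third vertex, a
    common neighbour in the heavy graph. *)
Let heavy_edges : 6 * #|E'|%:R <= triangles R (heavy E).
Proof.
have E'3 e : e \in E' -> #|e| = 3%N by rewrite inE => /andP[/E3].
have := sum_pair_degree E'3 => S.
rewrite mulrC -[6 in leLHS]/((3 * 2)%N%:R) -natrM -S natr_sum; apply: ler_sum => x _.
rewrite natr_sum; apply: ler_sum => y _.
have -> : codegree R (heavy E) x y = #|[set z | heavy E x z && heavy E y z]|%:R.
  rewrite -sum1_card natr_sum [RHS]big_mkcond /=; apply: eq_bigr => z _.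
  by rewrite inE; case: (_ && _).
rewrite -natrM ler_nat.
have [->|xy] := eqVneq x y; first by rewrite mul0n.
rewrite mul1n.
have hE' e u v : e \in E' -> u \in e -> v \in e -> u != v -> heavy E u v.
  by rewrite inE => /andP[_ /forallP/(_ u)/implyP/[apply]/forallP/(_ v)/implyP/[apply]/implyP].
case: (posnP (pair_degree E' x y)) => [-> //|/card_gt0P[e0]].
rewrite inE => /and3P[e0E' xe0 ye0]; rewrite (hE' e0) // mul1n.
apply: leq_trans (leq_imset_card (fun z => [set x; y; z]) _).
apply: subset_leq_card; apply/fintype.subsetP => e; rewrite inE => /and3P[eE' xe ye].
have : (0 < #|e :\ x :\ y|)%N.
  have := E'3 e eE'; rewrite (cardsD1 x) xe (cardsD1 y) !inE eq_sym xy ye; lia.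
case/card_gt0P=> z; rewrite !inE => /and3P[zy zx ze].
apply/imsetP; exists z.
  by rewrite inE (hE' e) ?(hE' e) // eq_sym.
apply: (edge_eq E'3 eE' xe ye ze).
by rewrite /= !inE negb_or xy (eq_sym x) zx (eq_sym y) zy.
Qed.

Lemma edges_le_triangles : 6 * #|E|%:R <= triangles R (heavy E) + 6 * #|T|%:R ^+ 2.
Proof.
have : (#|E| <= #|E'| + #|T| ^ 2)%N.
  rewrite -(cardsID E' E) leq_add //.
  by rewrite subset_leq_card // subsetIr.
rewrite -(ler_nat R) natrD natrX; have := heavy_edges; lra.
Qed.
End TripleCounting.

(** The six edges form a 3-graph of [K43] contained in [H], so it is not in [famD] and must embed in
    a star. By injectivity, the preimage of the centre is one vertex lying in all six edges. *)
Lemma famD_free_starlike (H : hypergraph 3) : fam_free famD H -> starlike (edges H).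
Proof.
move=> free a b c d e1 e2 e3 e4 e5 e6 un inE6 [a1 b1 a2 c2 a3] [d3 b4 c4 b5 d5] c6 d6.
set s := [:: e1; e2; e3; e4; e5; e6] in inE6 *.
have s3 e : e \in [set e in s] -> #|e| = 3%N.
  by rewrite inE => /(allP inE6) /edges_card.
pose F := Hypergraph s3.
have subF : subgraph F H.
  by exists id; split=> // e; rewrite imset_id inE => /(allP inE6).
have K : K43 F.
  split; first by rewrite cardsE (leq_trans (card_size _)).
  exists [set x in [:: a; b; c; d]]; split.
    by rewrite cardsE (card_uniqP un).
  have es i : (i < 6)%N -> nth finset.set0 s i \in edges F by move=> ?; rewrite inE mem_nth.
  have i1 := es 0%N isT; have i2 := es 1%N isT; have i3 := es 2%N isT.
  have i4 := es 3%N isT; have i5 := es 4%N isT; have i6 := es 5%N isT.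
  move=> u v; rewrite !inE => /or4P[] /eqP-> /or4P[] /eqP->; rewrite ?eqxx // => _;
  by [exists e1 | exists e2 | exists e3 | exists e4 | exists e5 | exists e6].
have nD : ~ famD F by move=> D; exact: (free _ D).
have : ~ forall n (u : 'I_n), (4 <= n)%N -> ~ subgraph F (star u).
  by move=> nstar; apply: nD.
move=> /existsNP[n /existsNP[u /not_implyP[n4 /contrapT [f [f_inj fP]]]]].
have center e : e \in s -> u \in f @: e.
  move=> es; have /fP : e \in edges F by rewrite inE.
  by case/imsetP=> A _ ->; rewrite !inE eqxx.
have /imsetP[w we1 uw] := center e1 (mem_head _ _).
exists w; apply/allP => e /center /imsetP[w' w'e uw'].
by rewrite (f_inj w w') // -uw -uw'.
Qed.

(** * Edge bounds and the feasible region *)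

Section Bounds.
Variables (R : realFieldType) (H : hypergraph 3).
Hypothesis free : fam_free famD H.
Local Notation n := (#|vertex H|%:R : R).
Local Notation m := (#|edges H|%:R : R).
Let st := famD_free_starlike free.
Let E3 := @edges_card 3 H.

Let K4 : K4free (heavy (edges H)).
Proof. exact: (K4free_heavy (@heavy_adj _ _) (no_heavy_triangle_K4 E3 st)). Qed.

Lemma famD_free_edges : 0 < n -> 6 * m <= 2 / 9 * n ^+ 3 + 6 * n ^+ 2.
Proof.
move=> n_gt0; have := edges_le_triangles R E3.
have := triangles_K4free (@heavy_sym _ _) K4 (n_gt0 : 0 < graph_order R _).
rewrite /graph_order; lra.
Qed.

Lemma famD_free_edges_dense_shadow : 20 * 1000 <= n ->
  2 * n ^+ 2 < 6 * #|shadow_edges H|%:R ->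
  6 * m <= (2 / 9 - 1 / 1000 / 1000) * n ^+ 3 + 6 * n ^+ 2.
Proof.
move=> n_large dense; have := edges_le_triangles R E3.
suff : triangles R (heavy (edges H)) <= (2 / 9 - 1 / 1000 / 1000) * n ^+ 3 by lra.
rewrite leNgt; apply/negP => many.
have := arcs_of_many_triangles (@adj_sym _ (edges H)) (@heavy_sym _ (edges H))
  (@heavy_adj _ (edges H)) (no_heavy_triangle_K4 E3 st) (few_common_adj E3 st) n_large many.
rewrite -shadow_arcs /graph_order; lra.
Qed.
End Bounds.

(** * Densities of 3-graphs *)

Section Binomials.
Variable R : realFieldType.

Lemma bin2R n : 'C(n, 2)%:R = n%:R * (n%:R - 1) / 2 :> R.
Proof.
elim: n => [|n IH]; first by rewrite bin0n mul0r mul0r.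
by rewrite binS bin1 natrD IH -natr1; field.
Qed.

Lemma bin3R n : 'C(n, 3)%:R = n%:R * (n%:R - 1) * (n%:R - 2) / 6 :> R.
Proof.
elim: n => [|n IH]; first by rewrite bin0n !mul0r.
by rewrite binS natrD IH bin2R -natr1; field.
Qed.
End Binomials.

Section Density.
Variables (R : realType) (H : hypergraph 3).
Local Notation n := (#|vertex H|%:R : R).

Lemma density3E : density R H = 6 * #|edges H|%:R / (n * (n - 1) * (n - 2)).
Proof. by rewrite /density bin3R invf_div mulrA [_ * 6]mulrC. Qed.

Lemma density_shadowE : density R (shadow H) = 2 * #|shadow_edges H|%:R / (n * (n - 1)).
Proof. by rewrite /density /= bin2R invf_div mulrA [_ * 2]mulrC. Qed.

(** The term 20/n absorbs both 6n^2 and the passage from n^3 to n(n - 1)(n - 2). *)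
Lemma density_le (c : R) : 0 <= c -> c <= 1 -> 10 <= n ->
  6 * #|edges H|%:R <= c * n ^+ 3 + 6 * n ^+ 2 -> density R H <= c + 20 / n.
Proof.
move=> c0 c1 n10 le; rewrite density3E.
have d : 0 < n * (n - 1) * (n - 2) by rewrite !mulr_gt0; lra.
rewrite ler_pdivrMr //; apply: le_trans le _.
have -> : (c + 20 / n) * (n * (n - 1) * (n - 2)) =
  c * n ^+ 3 + 20 * (n - 1) * (n - 2) - c * (3 * n ^+ 2 - 2 * n).
  by field; lra.
have h1 : c * (3 * n ^+ 2 - 2 * n) <= 1 * (3 * n ^+ 2 - 2 * n).
  rewrite ler_wpM2r //.
  have -> : 3 * n ^+ 2 - 2 * n = n * (3 * n - 2) by ring.
  by rewrite mulr_ge0; lra.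
have h2 : 10 * n <= n ^+ 2 by rewrite expr2 ler_wpM2r; lra.
lra.
Qed.
End Density.

(** * Feasible points by finite approximation, and attained maxima *)

Section Feasible.
Variables (R : realType) (r : nat) (Fam : hypergraph r -> Prop).
Implicit Types x y : R.

Lemma inv_natS_small (e : R) : 0 < e -> exists K, forall k, (K <= k)%N -> k.+1%:R^-1 < e.
Proof.
move=> e0; have [K _ KP] := near_infty_natSinv_lt (PosNum e0).
by exists K => k; apply: KP.
Qed.

Lemma le_of_inv_natS x y (C : R) : 0 < C ->
  (exists K, forall k, (K <= k)%N -> x <= y + C * k.+1%:R^-1) -> x <= y.
Proof.
move=> C0 [K KP]; rewrite leNgt; apply/negP => xy.
have xyC : 0 < (x - y) / C by rewrite divr_gt0 // subr_gt0.
have [K' K'P] := inv_natS_small xyC.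
have le1 := KP (maxn K K') (leq_maxl _ _).
have := K'P (maxn K K') (leq_maxr _ _).
rewrite ltr_pdivlMr //; move: le1; move: (_^-1) => v le1 lt1. lra.
Qed.

(** One approximating hypergraph is chosen for each [k]; the condition on its order makes the chosen
    sequence good. *)
Lemma feasibleP x y : feasible Fam (x, y) <->
  [/\ 0 <= x <= 1, 0 <= y <= 1 & forall k, exists H,
    [/\ fam_free Fam H, (k <= #|vertex H|)%N,
      `|x - density R (shadow H)| < k.+1%:R^-1 & `|y - density R H| < k.+1%:R^-1]].
Proof.
split=> [[/= x01 y01 [H [free [[+ _ _] + +]]]]|[x01 y01 apx]].
  move=> /cvgnyPge big /cvgrPdist_lt cx /cvgrPdist_lt cy; split=> // k.
  have k0 : 0 < k.+1%:R^-1 :> R by rewrite invr_gt0.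
  have [t [? [? ?]]] := filter_ex (filterI (big k) (filterI (cx _ k0) (cy _ k0))).
  by exists (H t).
split=> //=; have [H HP] := choice apx.
exists H; split; first by move=> k; case: (HP k).
have conv (f : nat -> R) (l : R) :
    (forall k, `|l - f k| < k.+1%:R^-1) -> (f k @[k --> \oo] --> l)%classic.
  move=> fl; apply/cvgrPdist_lt => e e0; have [K KP] := inv_natS_small e0.
  by exists K => // k Kk; apply: lt_trans (fl k) (KP k Kk).
have cx : (density R (shadow (H k)) @[k --> \oo] --> x)%classic.
  by apply: conv => k; case: (HP k).
have cy : (density R (H k) @[k --> \oo] --> y)%classic.
  by apply: conv => k; case: (HP k).
split=> //; split; [|exact: cvgP cy|exact: cvgP cx].
apply/cvgnyPge => B; exists B => // k Bk; case: (HP k) => _ kH _ _.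
exact: leq_trans kH.
Qed.

(** Fibres of the feasible region are closed: hypergraphs approximating points of the fibre near its
    supremum also approximate the supremum. *)
Lemma is_g_exists x y0 : feasible Fam (x, y0) -> exists m, is_g Fam x m.
Proof.
move=> f0; pose S : set R := fun y => feasible Fam (x, y).
have S1 : ubound S 1 by move=> y [_ /andP[]].
have Sub : has_ubound S by exists 1.
have Sne : (S !=set0)%classic by exists y0.
exists (sup S); split; last by move=> y Sy; apply: ub_le_sup.
have /feasibleP[x01 y01 _] := f0.
apply/feasibleP; split=> //.
  have /andP[y0_ge _] := y01.
  by rewrite (le_trans y0_ge) ?ub_le_sup //= ge_sup.
(* The error 1/(k + 1) is halved between the point [y] and its approximation [H]; index [k.+1 + k]
   gives precision 1/(2k + 2). *)
move=> k; have k0 : 0 < (k.+1 + k.+1)%:R^-1 :> R by rewrite invr_gt0.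
have [y Sy ly] := sup_adherent k0 (conj Sne Sub).
have /feasibleP[_ _ /(_ (k.+1 + k)%N)[H [free kH dx dy]]] := Sy.
exists H; split=> //; first by lia.
  apply: lt_trans dx _; rewrite ltf_pV2 ?posrE ?ltr0n // ltr_nat; lia.
have yle : y <= sup S by apply: ub_le_sup.
have half : (k.+1 + k.+1)%:R^-1 + (k.+1 + k.+1)%:R^-1 = k.+1%:R^-1 :> R.
  by rewrite addnn -muln2 natrM invfM -splitr.
rewrite -addnS in dy; rewrite -half.
have -> : sup S - density R H = (sup S - y) + (y - density R H) by ring.
apply: le_lt_trans (ler_normD _ _) _; apply: ltrD => //.
by rewrite ger0_norm ?subr_ge0 //; lra.
Qed.
End Feasible.

(** * Constructions *)

Section PartialStar.
Variables (n m : nat).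
Hypothesis m_le : (m <= n.+1)%N.

(** The centre is [ord0], and vertices from [m] on are isolated. Varying [m] tunes the shadow
    density, while the edge density tends to 0. *)
Definition leaves : {set 'I_n.+1} := [set v : 'I_n.+1 | (0 < v < m)%N].

Definition partial_star_edges : {set {set 'I_n.+1}} :=
  [set ord0 |: A | A : {set 'I_n.+1} & (A \subset leaves) && (#|A| == 2%N)].

Lemma partial_star_sub : partial_star_edges \subset star_edges (ord0 : 'I_n.+1).
Proof.
apply/fintype.subsetP => e /imsetP[A]; rewrite inE => /andP[/fintype.subsetP sA cA] ->.
apply/imsetP; exists A => //; rewrite inE cA andbT.
apply/fintype.subsetP => v /sA; rewrite !inE => /andP[v0 _].
by apply/eqP => E; rewrite E in v0.
Qed.

Lemma partial_star_edges_card (e : {set 'I_n.+1}) : e \in partial_star_edges -> #|e| = 3%N.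
Proof. by move/(fintype.subsetP partial_star_sub)/star_edges_card. Qed.

Definition partial_star : hypergraph 3 := Hypergraph partial_star_edges_card.

Lemma partial_star_free : (4 <= n.+1)%N -> fam_free famD partial_star.
Proof.
move=> n4 F [_ nstar] [f [f_inj fP]]; apply: (nstar n.+1 ord0 n4).
by exists f; split=> // e /fP /(fintype.subsetP partial_star_sub).
Qed.

Lemma partial_star_size : (#|edges partial_star| <= 'C(n.+1, 2))%N.
Proof.
apply: leq_trans (leq_imset_card _ _) _.
have := card_draws 'I_n.+1 2; rewrite card_ord => <-.
by apply: subset_leq_card; apply/fintype.subsetP => A; rewrite !inE => /andP[].
Qed.

Lemma partial_star_adj (u v : 'I_n.+1) : (3 <= m)%N ->
  adj (edges partial_star) u v = [&& u != v, (u < m)%N & (v < m)%N].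
Proof.
move=> m3; apply/idP/and3P.
  move=> /adjP[uv [e [/imsetP[A]]]]; rewrite inE => /andP[/fintype.subsetP sA _] ->.
  have lt w : w \in ord0 |: A -> (w < m)%N.
    by rewrite !inE => /orP[/eqP->|/sA]; [apply: leq_trans m3|rewrite inE => /andP[]].
  by move=> /lt ? /lt ?.
case=> uv um vm; rewrite /adj uv /=.
have edge (A : {set 'I_n.+1}) : A \subset leaves -> #|A| = 2%N ->
    u \in ord0 |: A -> v \in ord0 |: A -> (0 < pair_degree (edges partial_star) u v)%N.
  move=> sA cA uA vA; apply/card_gt0P; exists (ord0 |: A); rewrite inE uA vA !andbT.
  by apply/imsetP; exists A; rewrite // inE sA cA eqxx.
(* A pair containing the centre needs a second leaf to extend to an edge; [3 <= m] provides one. *)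
have third (w : 'I_n.+1) : (0 < w < m)%N -> exists w' : 'I_n.+1, (0 < w' < m)%N /\ w != w'.
  move=> w0m; pose k := (if w == 1 :> nat then 2 else 1)%N.
  have k3 : (k < 3)%N by rewrite /k; case: eqP.
  have kn : (k < n.+1)%N by apply: leq_trans m_le; apply: leq_trans m3.
  exists (Ordinal kn); split; first by rewrite /= (leq_trans k3) // /k; case: eqP.
  by apply/eqP => /(congr1 val) /=; rewrite /k; case: eqP => [->|].
have pair (a b : 'I_n.+1) : (0 < a < m)%N -> (0 < b < m)%N -> [set a; b] \subset leaves.
  by move=> ha hb; apply/fintype.subsetP => x; rewrite !inE => /orP[] /eqP->.
have [u0|u0] := posnP u.
  have v0 : (0 < v < m)%N by rewrite vm andbT lt0n -u0 eq_sym.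
  have [w [wm vw]] := third _ v0.
  apply: (edge [set v; w]); rewrite ?pair ?cards2 ?vw // !inE ?eqxx ?orbT //.
  by have -> : u == ord0 by apply/eqP/val_inj.
have [v0|v0] := posnP v.
  have u0m : (0 < u < m)%N by rewrite u0.
  have [w [wm uw]] := third _ u0m.
  apply: (edge [set u; w]); rewrite ?pair ?cards2 ?uw // !inE ?eqxx ?orbT //.
  by have -> : v == ord0 by apply/eqP/val_inj.
by apply: (edge [set u; v]); rewrite ?pair ?u0 ?v0 ?cards2 ?uv // !inE eqxx ?orbT.
Qed.

Lemma partial_star_shadow (R : realFieldType) : (3 <= m)%N ->
  2 * #|shadow_edges partial_star|%:R = m%:R * (m%:R - 1) :> R.
Proof.
move=> m3; rewrite shadow_arcs.
pose P (u : 'I_n.+1) := (u < m)%N.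
have cP : cnt R P = m%:R.
  rewrite /cnt -natr_sum -big_mkcond /= -(big_ord_widen n.+1 (fun=> 1%N) m_le).
  by rewrite sum1_card card_ord.
have : arcs R (adj (edges partial_star)) + cnt R P = cnt R P * cnt R P.
  rewrite -cnt_pairs -big_split; apply: eq_bigr => u _ /=.
  have -> : (P u)%:R = \sum_v ((u == v) && P v)%:R :> R.
    rewrite (bigD1 u) //= eqxx big1 ?addr0 // => v; rewrite eq_sym => /negbTE ->.
    by [].
  rewrite -big_split; apply: eq_bigr => v _ /=.
  rewrite partial_star_adj // -natrD /P; congr _%:R.
  by case: eqP => [->|] /=; case: (_ < m)%N; case: (_ < m)%N.
rewrite cP => E; lra.
Qed.
End PartialStar.

(** Consecutive values m(m - 1) and (m + 1)m differ by 2m. The search starts at 3, the least [m] for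
    which the star has an edge. *)
Lemma exists_triangular (R : realFieldType) (n : nat) (t : R) : (3 <= n)%N -> 0 <= t ->
  t <= n%:R * (n%:R - 1) ->
  exists m, [/\ (3 <= m)%N, (m <= n)%N & `|t - m%:R * (m%:R - 1)| <= 2 * n%:R].
Proof.
move=> n3 t0; elim: n n3 => // n IH; rewrite leq_eqVlt => /orP[/eqP [<-] tn|n3 tn].
  by exists 3%N; split=> //; rewrite ler_norml; lra.
have [le|gt] := lerP t (n%:R * (n%:R - 1)).
  have [m [m3 mn le']] := IH n3 le; exists m; split=> //; first exact: leqW.
  by apply: le_trans le' _; rewrite -natr1; lra.
exists n.+1; split=> //; first exact: leqW.
by move: tn; rewrite -natr1 ler_norml => tn; lra.
Qed.

Lemma feasible_star (R : realType) (x : R) : 0 <= x <= 1 -> feasible famD (x, 0).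
Proof.
move=> x01; have [x0 x1] := andP x01.
apply/feasibleP; split=> //; first by rewrite lexx ler01.
(* The shadow error is at most 2/(N - 1) and the edge density at most 3/(N - 2); N = 3(k + 1) + 7
   puts both below 1/(k + 1). *)
move=> k; pose n := (3 * k + 9)%N.
set N : R := n.+1%:R.
have NE : N = 3 * k.+1%:R + 7 by rewrite /N /n -!natr1 natrD natrM; ring.
have k1 : 1 <= k.+1%:R :> R by rewrite ler1n.
have kN : k.+1%:R^-1 > 0 :> R by rewrite invr_gt0; lra.
have N10 : 10 <= N by rewrite NE; lra.
have d2 : 0 < N * (N - 1) by rewrite mulr_gt0; lra.
have [m [m3 mn mx]] : exists m, [/\ (3 <= m)%N, (m <= n.+1)%N &
    `|x * (N * (N - 1)) - m%:R * (m%:R - 1)| <= 2 * N].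
  apply: exists_triangular; [by rewrite /n; lia|by rewrite mulr_ge0 // ltW|].
  by rewrite -/N ler_piMl // ltW.
exists (partial_star n m); split.
- by apply: partial_star_free; rewrite /n; lia.
- by rewrite card_ord /n; lia.
- rewrite density_shadowE partial_star_shadow // card_ord -/N.
  have -> : x - m%:R * (m%:R - 1) / (N * (N - 1)) =
      (x * (N * (N - 1)) - m%:R * (m%:R - 1)) / (N * (N - 1)) by field; lra.
  rewrite normrM (gtr0_norm (_ : 0 < (N * (N - 1))^-1)) ?invr_gt0 //.
  rewrite ltr_pdivrMr //; apply: le_lt_trans mx _.
  rewrite [ltRHS]mulrC ltr_pdivlMr; last lra.
  have : 0 < N * (N - 1 - 2 * k.+1%:R) by rewrite mulr_gt0; lra.
  lra.
- rewrite sub0r normrN density3E card_ord -/N.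
  have := partial_star_size n m; rewrite -(ler_nat R) bin2R -/N => le.
  have d3 : 0 < N * (N - 1) * (N - 2) by rewrite mulr_gt0; lra.
  rewrite ger0_norm; last by rewrite mulr_ge0 ?invr_ge0 ?(ltW d3) // mulr_ge0.
  rewrite ltr_pdivrMr // [ltRHS]mulrC ltr_pdivlMr; last lra.
  apply: le_lt_trans (_ : 3 * (N * (N - 1)) * k.+1%:R < _).
    by rewrite ler_wpM2r; lra.
  have : 0 < (N * (N - 1)) * (N - 2 - 3 * k.+1%:R) by rewrite mulr_gt0; lra.
  lra.
Qed.

(** * Balanced complete 3-partite 3-graphs *)

Section Tripartite.
Variable k : nat.

(** The first coordinate of a vertex is its class; choosing one vertex per class amounts to a
    function, and the edge is its graph. *)
Definition transversal (f : {ffun 'I_3 -> 'I_k}) : {set 'I_3 * 'I_k} := [set (i, f i) | i : 'I_3].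

Lemma mem_transversal f x : (x \in transversal f) = (x.2 == f x.1).
Proof.
by apply/imsetP/eqP => [[i _ -> //]|xf]; exists x.1; rewrite // -xf -surjective_pairing.
Qed.

Lemma transversal_inj : injective transversal.
Proof.
move=> f g /setP fg; apply/ffunP => i.
by have := fg (i, f i); rewrite !mem_transversal /= eqxx => /esym/eqP.
Qed.

Lemma transversal_card (e : {set 'I_3 * 'I_k}) : 
  e \in [set transversal f | f in predT] -> #|e| = 3%N.
Proof.
by case/imsetP=> f _ ->; rewrite card_imset ?card_ord // => i j [].
Qed.

Definition tripartite : hypergraph 3 := Hypergraph transversal_card.

Lemma tripartite_size : #|edges tripartite| = (k ^ 3)%N.
Proof. by rewrite card_imset ?card_ffun ?card_ord //; apply: transversal_inj. Qed.

Lemma tripartite_adj (x y : 'I_3 * 'I_k) : adj (edges tripartite) x y = (x.1 != y.1).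
Proof.
apply/idP/idP => [/adjP[xy [e [/imsetP[f _ ->]]]]|xy].
  rewrite !mem_transversal => /eqP xf /eqP yf; apply: contraNneq xy => E.
  by rewrite (surjective_pairing x) (surjective_pairing y) xf yf E.
rewrite /adj; apply/andP; split; first by apply: contraNneq xy => ->.
apply/card_gt0P; exists (transversal [ffun i => if i == x.1 then x.2 else y.2]).
rewrite inE imset_f //= !mem_transversal !ffunE eqxx [y.1 == _]eq_sym (negbTE xy).
by rewrite !eqxx.
Qed.

Lemma tripartite_shadow (R : realFieldType) :
  2 * #|shadow_edges tripartite|%:R = 6 * k%:R ^+ 2 :> R.
Proof.
rewrite shadow_arcs.
have : arcs R (adj (edges tripartite)) + \sum_(x : 'I_3 * 'I_k) k%:R =
    \sum_(x : 'I_3 * 'I_k) (3 * k)%:R.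
  rewrite -big_split; apply: eq_bigr => x _ /=.
  have -> : k%:R = \sum_(y : 'I_3 * 'I_k) (x.1 == y.1)%:R :> R.
    rewrite -(pair_big predT predT (fun i (_ : 'I_k) => (x.1 == i)%:R)) /=.
    rewrite (bigD1 x.1) //= eqxx sumr_const card_ord big1 ?addr0 // => i ix.
    by rewrite big1 // => j _; rewrite eq_sym (negbTE ix).
  rewrite -big_split /= -[RHS]mulr1 mulr_natl.
  have -> : (3 * k)%N = #|{: 'I_3 * 'I_k}| by rewrite card_prod !card_ord.
  rewrite -sumr_const; apply: eq_bigr => y _ /=.
  by rewrite tripartite_adj -natrD; case: (_ == _).
rewrite !sum_const_R /graph_order card_prod !card_ord natrM => E; lra.
Qed.

(** Vertices covered by a common edge lie in different classes, so three classes cannot accommodate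
    a 4-set with all pairs covered. *)
Lemma tripartite_free : fam_free famD tripartite.
Proof.
move=> F [[_ [S [S4 cov]]] _] [f [f_inj fP]].
have inj : {in S &, injective (fun u => (f u).1)}.
  move=> u v uS vS E; apply/eqP; case: eqVneq => // uv.
  have [e [/fP/imsetP[g _ eg] ue ve]] := cov u v uS vS uv.
  have := imset_f f ue; have := imset_f f ve.
  rewrite eg !mem_transversal => /eqP gv /eqP gu.
  have /f_inj : f u = f v by rewrite (surjective_pairing (f u)) (surjective_pairing (f v)) gu gv E.
  by move/eqP; rewrite (negbTE uv).
have := max_card (mem [set (f u).1 | u in S]).
by rewrite card_in_imset // S4 card_ord.
Qed.
End Tripartite.

Lemma feasible_tripartite (R : realType) : feasible famD (2 / 3 : R, 2 / 9).
Proof.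
apply/feasibleP; split; [by lra|by lra|move=> k].
pose N : R := k.+1%:R.
have N1 : 1 <= N by rewrite ler1n.
exists (tripartite k.+1); split.
- exact: tripartite_free.
- by rewrite card_prod !card_ord; lia.
- rewrite density_shadowE tripartite_shadow card_prod !card_ord natrM -/N.
  have -> : 2 / 3 - 6 * N ^+ 2 / (3 * N * (3 * N - 1)) = - (2 / (3 * (3 * N - 1))).
    by field; rewrite !gt_eqF //; lra.
  rewrite normrN gtr0_norm; last by rewrite divr_gt0; lra.
  by rewrite -[ltRHS]div1r ltr_pdivrMr 1?mulrAC ?ltr_pdivlMr; lra.
- rewrite density3E tripartite_size card_prod !card_ord natrM natrX -/N.
  have -> : 2 / 9 - 6 * N ^+ 3 / (3 * N * (3 * N - 1) * (3 * N - 2)) =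
     - (2 * (9 * N - 2) / (9 * ((3 * N - 1) * (3 * N - 2)))).
    by field; rewrite !gt_eqF //; lra.
  have d : 0 < (3 * N - 1) * (3 * N - 2) by rewrite mulr_gt0; lra.
  rewrite normrN gtr0_norm; last by rewrite divr_gt0 // mulr_gt0; lra.
  rewrite -[ltRHS]div1r ltr_pdivrMr; last lra.
  rewrite mulrAC ltr_pdivlMr; last lra.
  have := sqr_ge0 (N - 1).
  lra.
Qed.

(** * Upper bounds on feasible points, and the theorem *)

(** [K0] serves as threshold both for the order and for the closeness of the shadow density. The
    constant 21 is the 20 of [density_le] plus 1 for the approximation of [y]. *)
Lemma feasible_famD_le (R : realType) (x y c : R) (K0 : nat) : 0 <= c -> c <= 1 ->
  (forall H : hypergraph 3, fam_free famD H -> (K0 <= #|vertex H|)%N ->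
    `|x - density R (shadow H)| < K0.+1%:R^-1 ->
    6 * #|edges H|%:R <= c * #|vertex H|%:R ^+ 3 + 6 * #|vertex H|%:R ^+ 2 :> R) ->
  feasible famD (x, y) -> y <= c.
Proof.
move=> c0 c1 bound /feasibleP[_ _ apx]; apply: (@le_of_inv_natS _ _ _ 21); first by lra.
exists (K0 + 10)%N => k kK; have [H [free kH dx dy]] := apx k.+1.
have k1 : 0 < k.+1%:R :> R by rewrite ltr0n.
have nk : k.+1%:R <= #|vertex H|%:R :> R by rewrite ler_nat.
have n10 : 10 <= #|vertex H|%:R :> R by rewrite (ler_nat R 10); lia.
have inv_le (i j : nat) : (i <= j)%N -> j.+1%:R^-1 <= i.+1%:R^-1 :> R.
  by move=> ij; rewrite lef_pV2 ?posrE ?ltr0n // ler_nat.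
have dens : density R H <= c + 20 / #|vertex H|%:R.
  apply: density_le => //; apply: bound => //; first by lia.
  by apply: lt_le_trans dx _; apply: inv_le; lia.
have inv : #|vertex H|%:R^-1 <= k.+1%:R^-1 :> R by rewrite lef_pV2 ?posrE //; lra.
have := inv_le _ _ (leqnSn k).
move: dy; rewrite ltr_norml => /andP[_ dy].
move: dens dy inv; move: (#|vertex H|%:R^-1) (k.+1%:R^-1) (k.+2%:R^-1) => u v w.
lra.
Qed.

Lemma feasible_le (R : realType) (x y : R) : feasible famD (x, y) -> y <= 2 / 9.
Proof.
apply: (@feasible_famD_le _ _ _ _ 1); [by lra|by lra|move=> H free n1 _].
by apply: famD_free_edges; rewrite ?ltr0n.
Qed.

Lemma feasible_le_gap (R : realType) (eps y : R) : 0 < eps ->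
  feasible famD (2 / 3 + eps, y) -> y <= 2 / 9 - 1 / 1000 / 1000.
Proof.
move=> eps0 feas; have /feasibleP[/= /andP[_ eps1] _ _] := feas.
have eps4 : 0 < eps / 4 by rewrite divr_gt0.
(* [K] brings the shadow density within eps/4 of its limit; the summand 20 * 1000 meets the order
   required by [famD_free_edges_dense_shadow]. *)
have [K KP] := inv_natS_small eps4.
move: feas; apply: (@feasible_famD_le _ _ _ _ (K + 20 * 1000)); [by lra|by lra|].
move=> H free Kn; have := KP _ (leq_addr (20 * 1000) K).
have : (K + 20 * 1000)%:R <= #|vertex H|%:R :> R by rewrite ler_nat.
have : 20 * 1000 <= (K + 20 * 1000)%:R :> R by rewrite natrD natrM lerDr.
rewrite -[(K + 20 * 1000).+1%:R]natr1; move: (K + 20 * 1000)%:R => L L_ge nL inv_lt.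
have L1 : 0 < L + 1 by lra.
rewrite ltr_norml => /andP[_ dx].
apply: famD_free_edges_dense_shadow => //; first by lra.
have epsL : 4 < eps * (L + 1).
  have : (L + 1)^-1 * (L + 1) < eps / 4 * (L + 1) by rewrite ltr_pM2r.
  by rewrite mulVf ?gt_eqF //; lra.
have : 2 / 3 + 3 / 4 * eps < density R (shadow H).
  by move: dx inv_lt; move: (_^-1) => invL dx inv_lt; lra.
rewrite density_shadowE; move: nL; move: (#|vertex H|%:R) => n nL.
have n1 : 0 < n * (n - 1) by rewrite mulr_gt0; lra.
rewrite ltr_pdivlMr // => lt.
(* Since eps(n + 1) > 4, the gain of order eps n^2 outweighs the 2n lost between n(n - 1) and
   n^2. *)
have : 0 < n * (eps * (n + 1) - 4).
  rewrite mulr_gt0; [by []|by lra|].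
  have : eps * (L + 1) <= eps * (n + 1) by rewrite ler_wpM2l ?(ltW eps0) //; lra.
  lra.
have : eps * n <= 1 / 3 * n by rewrite ler_wpM2r; lra.
have : 20 * 1000 * n <= n * n by rewrite ler_wpM2r; lra.
lra.
Qed.

Theorem theorem1p12 (R : realType) :
  [/\ proj_feasible famD = [set x : R | 0 <= x <= 1]%classic,
      is_g famD (2 / 3 : R) (2 / 9) &
      exists delta0 : R, 0 < delta0 /\
        forall eps : R, 0 < eps -> eps < 10 ^- 8 ->
          exists m : R, is_g famD (2 / 3 + eps) m /\ m < 2 / 9 - delta0].
Proof.
split.
- apply/seteqP; split=> x /=; first by case=> y [].
  by move=> x01; exists 0; apply: feasible_star.
- by split; [exact: feasible_tripartite|exact: feasible_le].
(* Half of the gap in [feasible_le_gap], to turn its weak inequality into a strict one. *)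
exists (1 / 1000 / 1000 / 2); split; first by lra.
move=> eps eps0 eps1.
have x01 : 0 <= 2 / 3 + eps <= 1.
  suff : 10 ^- 8 <= 1 / 3 :> R by lra.
  have p : 3 <= 10 ^+ 8 :> R by rewrite -natrX ler_nat.
  by rewrite div1r lef_pV2 ?posrE //; lra.
have [m gm] := is_g_exists (feasible_star x01).
exists m; split=> //.
have [/(feasible_le_gap eps0) le _] := gm; lra.
Qed.
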